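(* Let $d\ge 1$ be an integer. 1) Let $s\in(0,d)$. If $E\subset\mathbb{R}^d$ is a Borel set that is mid-point convex but not essentially convex, then $\mathcal{H}^s(E)=0$ or $\mathcal{H}^s(E)=\infty$. Moreover, there exist Borel sets $E_1,E_2\subset\mathbb{R}^d$, both of Hausdorff dimension $s$ and both mid-point convex but not essentially convex, such that $\mathcal{H}^s(E_1)=0$ and $\mathcal{H}^s(E_2)=\infty$. 2) Let $s=d$. There exists a Borel set $E\subset\mathbb{R}^d$ of Hausdorff dimension $s$ that is mid-point convex but not essentially convex and satisfies $\mathcal{H}^s(E)=0$.
   Context: $\mathcal{H}^s$ denotes the $s$-dimensional Hausdorff measure on $\mathbb{R}^d$. A set $E\subset\mathbb{R}^d$ is mid-point convex if $\frac{x+y}{2}\in E$ whenever $x,y\in E$. A set $E\subset\mathbb{R}^d$ is essentially convex if there exist an integer $m\in[1,d]$ and a translate $L_m$ of an $m$-dimensional linear subspace of $\mathbb{R}^d$ such that $E\subset L_m$ and, with respect to the induced topology on $L_m$, the interior of $E$ is non-empty and $\mathrm{ch}(E)\setminus E\subset\partial(\mathrm{ch}(E))$, where $\mathrm{ch}(E)$ is the convex hull of $E$ and the boundary $\partial$ is taken in $L_m$. *)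

(* Defs.v *)
From HB Require Import structures.
From mathcomp Require Import all_boot all_order all_algebra.
From mathcomp Require Import all_classical all_reals all_analysis.

Set Implicit Arguments.
Unset Strict Implicit.
Unset Printing Implicit Defensive.
Import Order.TTheory GRing.Theory Num.Theory.
Import numFieldNormedType.Exports.

Local Open Scope classical_set_scope.
Local Open Scope ring_scope.

Definition borel_set {R : realType} {d : nat} (E : set 'rV[R]_d) : Prop :=
  <<s [set U : set 'rV[R]_d | open U] >> E.

Section Hausdorff.
Context {R : realType} {d : nat}.
Implicit Types (U E : set 'rV[R]_d) (s delta : R).

(* The library's norm `|x| on 'rV[R]_d is the sup norm, hence this one. *)
Definition enorm (x : 'rV[R]_d) : R := Num.sqrt (\sum_(i < d) x 0 i ^+ 2).

(* The maximum with 0 only matters for U = set0, as ereal_sup set0 = -oo. *)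
Definition diam U : \bar R :=
  maxe 0%E (ereal_sup [set (enorm (x - y))%:E | x in U & y in U]).

(* |U|^s, where the empty set counts for 0 even if s = 0. *)
Definition diam_pow s U : \bar R :=
  if U == set0 then 0%E else (diam U `^ s)%E.

Definition delta_cover delta E (U : nat -> set 'rV[R]_d) : Prop :=
  E `<=` \bigcup_i U i /\ forall i, (diam (U i) <= delta%:E)%E.

Definition hausdorff_premeasure s delta E : \bar R :=
  ereal_inf [set (\sum_(0 <= i <oo) diam_pow s (U i))%E
            | U in [set U | delta_cover delta E U]].

(* The premeasure is nonincreasing in delta, so the supremum is the limit as
   delta tends to 0.  No normalizing constant is used. *)
Definition hausdorff_measure s E : \bar R :=
  ereal_sup [set hausdorff_premeasure s delta E
            | delta in [set delta | 0 < delta]].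

Definition hausdorff_dim E : \bar R :=
  ereal_inf [set t%:E | t in [set t : R | 0 <= t /\
                                          hausdorff_measure t E = 0%E]].

End Hausdorff.

Section Convexity.
Context {R : realType} {d : nat}.
Implicit Types (E L : set 'rV[R]_d).

Definition midpoint_convex E : Prop :=
  forall x y, E x -> E y -> E (2^-1 *: (x + y)).

Definition convex_hull E : set 'rV[R]_d :=
  smallest (@convex_set R 'rV[R]_d) E.

Definition translate (a : 'rV[R]_d) (V : {vspace 'rV[R]_d}) : set 'rV[R]_d :=
  [set a + v | v in [set v | v \in V]].

(* Interior and boundary in the topology induced on L.  In the library,
   [subspace L] is the whole ambient type where points outside L are isolated;
   for A `<=` L this gives the interior and closure of A relative to L. *)
Definition rel_interior L (A : set 'rV[R]_d) : set 'rV[R]_d :=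
  @interior (subspace L) A.

Definition rel_boundary L (A : set 'rV[R]_d) : set 'rV[R]_d :=
  @closure (subspace L) A `\` rel_interior L A.

Definition essentially_convex E : Prop :=
  exists (m : nat) (a : 'rV[R]_d) (V : {vspace 'rV[R]_d}),
    let L := translate a V in
    [/\ (1 <= m <= d)%N, \dim V = m, E `<=` L,
        rel_interior L E !=set0
      & convex_hull E `\` E `<=` rel_boundary L (convex_hull E)].

End Convexity.

(* Main.v *)
Require Import Defs.
From HB Require Import structures.
From mathcomp Require Import all_boot all_order all_algebra.
From mathcomp Require Import all_classical all_reals all_analysis.
From mathcomp Require Import ring lra zify.

Set Implicit Arguments.
Unset Strict Implicit.
Unset Printing Implicit Defensive.
Import Order.TTheory GRing.Theory Num.Theory.
Import numFieldNormedType.Exports.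

Local Open Scope classical_set_scope.
Local Open Scope ring_scope.

(** Hausdorff measure is compared with net measures, where only half-open dyadic
    cells are used in covers and a cell of level [n] costs [q ^ n], [q = 2 ^- s].
    The two agree up to constants ([hausdorff_null_of_net], [net_le_hausdorff]),
    and all the claims are insensitive to constants.  Cells of a given level are
    disjoint, so net measures are additive over them, and they scale exactly.

    For the zero-infinity law, take affinely independent points of [E] spanning
    its affine hull, of dimension [m], and use affine coordinates in which they
    are the origin and the basis vectors.  The means of [2 ^ k] points of [E] then
    include [2 ^- k * (x + l)] for [x] in [E] and [l] in a large piece of the
    integer lattice.  If [m < s] the measure is zero.  If [s < m], these about
    [2 ^ (k * m)] copies of a part of [E] of positive content lie in distinct
    cells and each carries the fraction [2 ^ (- k * s)] of that content, so the
    measure is infinite ([net_unbounded]).  If [m = s], the copies show that [E]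
    contains, up to a null set, all the points of some cell whose orbit under
    doubling modulo the integers meets a given set of positive measure; by a
    zero-one law for the doubling map ([net_zero_one]) almost every point is of
    this kind.  A set containing almost all of a cell meets its reflections in
    nearby points, so midpoint convexity gives interior points
    ([critical_interior]), and a midpoint convex set with interior points in its
    affine hull is essentially convex ([hull_sub_boundary]).

    The examples consist of the points all of whose coordinates have vanishing
    binary digits in very long, very sparse windows, up to a shift of the start of
    the windows ([near_dyadic]).  Digits outside the windows are free, which gives
    lower bounds for the measure ([net_digit_set]); the end of a window gives an
    efficient cover ([near_dyadic_null]).  The ratio of the ends of the windows
    fixes the dimension, and a lower order correction decides between measure zero
    and measure infinity.  Numbers like [1 / 3] have no such windows, so the sets
    have dense complement and are not essentially convex. *)

(** * Sums over sets *)

Lemma le_esum_subset (R : realType) (T : choiceType) (I J : set T)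
    (a : T -> \bar R) : I `<=` J -> (forall i, 0 <= a i)%E ->
  (\esum_(i in I) a i <= \esum_(i in J) a i)%E.
Proof.
move=> IJ a0; apply: ge_ereal_sup => _ [X [finX XI] <-]; apply: esum_ge.
by exists X => //; split=> //; apply: subset_trans IJ.
Qed.

Lemma le_esum_image (R : realType) (T T' : choiceType) (I : set T)
    (f : T -> T') (a : T' -> \bar R) : (forall y, 0 <= a y)%E ->
  (\esum_(y in f @` I) a y <= \esum_(i in I) a (f i))%E.
Proof.
move=> a0; have [->|/set0P[i0 _]] := eqVneq I set0.
  by rewrite image_set0 !esum_set0.
have /choice[g gP] : forall y, exists i, (f @` I) y -> I i /\ f i = y.
  move=> y; have [[i Ii fi]|nIy] := pselect ((f @` I) y); first by exists i.
  by exists i0.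
have gI : set_inj (f @` I) g.
  move=> y z; rewrite !inE => /gP[_ fy] /gP[_ fz] gyz.
  by rewrite -fy -fz gyz.
rewrite (eq_esum (b := fun y => a (f (g y)))); last by move=> y /gP[_ ->].
rewrite -(esum_image _ _ (a \o f) gI); apply: le_esum_subset => [i|i].
  by move=> [y /gP[? _] <-].
exact: a0.
Qed.

Lemma le_esumZ (R : realType) (T : choiceType) (I : set T) (k : R)
    (a : T -> \bar R) : 0 <= k -> (forall i, 0 <= a i)%E ->
  (\esum_(i in I) (k%:E * a i) <= k%:E * \esum_(i in I) a i)%E.
Proof.
move=> k0 a0; apply: ge_ereal_sup => _ [X [finX XI] <-].
rewrite -ge0_mule_fsumr//; apply: lee_wpmul2l; first by rewrite lee_fin.
by apply: ereal_sup_ubound; exists X.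
Qed.

Lemma esum_geometric (R : realType) (T : countType) (I : set T) (e : R) :
  0 <= e -> (\esum_(i in I) (e / 2 ^+ (pickle i).+1)%:E <= e%:E)%E.
Proof.
move=> e0; pose a n : \bar R := (e / 2 ^+ n.+1)%:E.
have a0 n : (0 <= a n)%E by rewrite lee_fin divr_ge0// exprn_ge0.
rewrite -(esum_image I _ a) => [|i j _ _]; last exact: (pcan_inj pickleK).
apply: (le_trans (le_esum_subset (J := setT) _ a0)) => //.
rewrite -nneseries_esumT//.
have := @epsilon_trick R (fun=> 0%E) e xpredT (fun=> lexx _) e0.
rewrite [X in (_ <= X + _)%E]eseries0// add0e; congr (_ <= _)%E.
by apply: eq_eseriesr => i _; rewrite add0e natrX.
Qed.

Lemma esum_finType (R : realType) (T : finType) (a : T -> \bar R) :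
  (forall i, 0 <= a i)%E -> (\esum_(i in [set: T]) a i = \sum_i a i)%E.
Proof.
move=> a0; rewrite (@esum_fset _ _ setT)//; last exact: finite_finset.
rewrite (fsbigE (index_enum T)) ?index_enum_uniq//.
  by apply: eq_bigl => i; rewrite in_setT.
by move=> i _; rewrite mem_index_enum.
Qed.

(** * Dyadic cells and net measures *)

Section Net.
Context {R : realType} {m : nat}.
Implicit Types (x y : 'rV[R]_m) (X Y : set 'rV[R]_m) (n k : nat).

Definition cell := (nat * 'rV[int]_m)%type.

Definition cell_of n x : 'rV[int]_m := \row_i Num.floor (2 ^+ n * x 0 i).

(** The half-open cube with corner [c.2 / 2 ^ c.1] and side [2 ^- c.1]. *)
Definition cube (c : cell) : set 'rV[R]_m := [set x | cell_of c.1 x = c.2].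

Lemma cube_cell_of n x : cube (n, cell_of n x) x.
Proof. by []. Qed.

Lemma cell_ofP n x (l : 'rV[int]_m) :
  (forall i, (l 0 i)%:~R <= 2 ^+ n * x 0 i < (l 0 i + 1)%:~R) <->
  cell_of n x = l.
Proof.
split=> [H|<- i]; last by rewrite mxE floor_itv.
by apply/rowP => i; rewrite mxE; apply: floor_def.
Qed.

Lemma cell_of_le n k x y : (n <= k)%N -> cell_of k x = cell_of k y ->
  cell_of n x = cell_of n y.
Proof.
wlog suff H : x y / (n <= k)%N -> cell_of k x = cell_of k y ->
    forall i, cell_of n y 0 i <= cell_of n x 0 i.
  by move=> nk xy; apply/rowP => i; apply/le_anti; rewrite !H.
move=> nk /rowP xy i; move: (xy i); rewrite !mxE => {}xy.
rewrite floor_ge_int; set z := Num.floor (2 ^+ n * y 0 i).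
have zk : 2 ^+ (k - n) * z <= Num.floor (2 ^+ k * y 0 i).
  rewrite floor_ge_int -[in leRHS](subnK nk) exprD -mulrA intrM rmorphXn/=.
  by rewrite ler_pM2l ?exprn_gt0// floor_le.
move: zk; rewrite -xy floor_ge_int intrM rmorphXn/=.
by rewrite -[in leRHS](subnK nk) exprD -mulrA ler_pM2l ?exprn_gt0.
Qed.

Lemma cube_coord_le c x y i : cube c x -> cube c y -> `|x 0 i - y 0 i| <= 2 ^- c.1.
Proof.
move=> /cell_ofP/(_ i)/andP[x1 x2] /cell_ofP/(_ i)/andP[y1 y2].
rewrite -[leRHS]mul1r ler_pdivlMr ?exprn_gt0// -[X in _ * X]ger0_norm ?exprn_ge0//.
rewrite -normrM mulrC mulrBr ler_norml.
by move: x1 x2 y1 y2; rewrite intrD => *; apply/andP; split; lra.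
Qed.

Variable q : R.
Hypothesis q0 : 0 < q.

(** The Hausdorff premeasure, with cells of level at least [n] as covering sets
    and [q ^ k] as the cost of a cell of level [k]. *)
Definition net n X : \bar R :=
  ereal_inf [set \esum_(c in S) (q ^+ c.1)%:E | S in
    [set S : set cell | X `<=` \bigcup_(c in S) cube c /\
                        forall c, S c -> (n <= c.1)%N]].

Let w0 (c : cell) : (0 <= (q ^+ c.1)%:E)%E.
Proof. by rewrite lee_fin exprn_ge0// ltW. Qed.

Lemma net_le n X (S : set cell) : X `<=` \bigcup_(c in S) cube c ->
  (forall c, S c -> (n <= c.1)%N) ->
  (net n X <= \esum_(c in S) (q ^+ c.1)%:E)%E.
Proof. by move=> XS Sn; apply: ereal_inf_lbound; exists S. Qed.

Lemma net_ge n X r :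
  (forall S : set cell, X `<=` \bigcup_(c in S) cube c ->
    (forall c, S c -> (n <= c.1)%N) -> (r <= \esum_(c in S) (q ^+ c.1)%:E)%E) ->
  (r <= net n X)%E.
Proof. by move=> H; apply: le_ereal_inf_tmp => _ [S [XS Sn] <-]; exact: H. Qed.

Lemma net_ge0 n X : (0 <= net n X)%E.
Proof. by apply: net_ge => S _ _; apply: esum_ge0 => c _; exact: w0. Qed.

(** Covers may be indexed by any family of cells, with repetitions. *)
Lemma net_family (T : choiceType) (I : set T) (f : T -> cell) n X :
  X `<=` \bigcup_(i in I) cube (f i) -> (forall i, I i -> (n <= (f i).1)%N) ->
  (net n X <= \esum_(i in I) (q ^+ (f i).1)%:E)%E.
Proof.
move=> XI In; apply: le_trans (le_esum_image I f w0).
apply: net_le => [x /XI[i Ii xi]|c [i Ii <-]]; last exact: In.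
by exists (f i) => //; exists i.
Qed.

Lemma net_finType (T : finType) (f : T -> cell) n k X :
  X `<=` \bigcup_i cube (f i) -> (forall i, (f i).1 = k) -> (n <= k)%N ->
  (net n X <= (#|T|%:R * q ^+ k)%:E)%E.
Proof.
move=> XT fk nk; apply: (le_trans (net_family XT _)) => [i _|].
  by rewrite fk.
rewrite esum_finType// (eq_bigr (fun=> (q ^+ k)%:E)) => [|i _]; last by rewrite fk.
by rewrite sumEFin sumr_const mulr_natl.
Qed.

Lemma le_net n X Y : X `<=` Y -> (net n X <= net n Y)%E.
Proof.
by move=> XY; apply: net_ge => S YS Sn; apply: net_le => //; apply: subset_trans YS.
Qed.

Lemma net_level n k X : (n <= k)%N -> (net n X <= net k X)%E.
Proof.
move=> nk; apply: net_ge => S XS Sk; apply: net_le => // c /Sk.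
exact: leq_trans.
Qed.

Lemma net_cube n (c : cell) : (n <= c.1)%N -> (net n (cube c) <= (q ^+ c.1)%:E)%E.
Proof.
move=> nc; apply: (le_trans (net_le (S := [set c]) _ _)).
- by rewrite bigcup_set1.
- by move=> _ ->.
- by rewrite esum_set1.
Qed.

Lemma net_approx n X (e : R) : 0 < e -> exists S : set cell,
  [/\ X `<=` \bigcup_(c in S) cube c, forall c, S c -> (n <= c.1)%N
    & (\esum_(c in S) (q ^+ c.1)%:E <= net n X + e%:E)%E].
Proof.
move=> e0; have [Xoo|] := eqVneq (net n X) +oo%E.
  exists [set c | (n <= c.1)%N]; split=> //; first by move=> x _; exists (n, cell_of n x) => /=.
  by rewrite Xoo leey.
move=> Xoo; have Xfin : net n X \is a fin_num.
  by rewrite ge0_fin_numE ?net_ge0// ltey.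
have : (net n X < net n X + e%:E)%E by rewrite lteDl// lte_fin.
by move=> /ereal_inf_lt[_ [S [XS Sn] <-] /ltW ?]; exists S.
Qed.

Lemma net_bigcup (T : countType) (I : set T) n (F : T -> set 'rV[R]_m) :
  (net n (\bigcup_(i in I) F i) <= \esum_(i in I) net n (F i))%E.
Proof.
apply/lee_addgt0Pr => e e0.
have /choice[S SP] : forall i, exists S : set cell,
  [/\ F i `<=` \bigcup_(c in S) cube c, forall c, S c -> (n <= c.1)%N
    & (\esum_(c in S) (q ^+ c.1)%:E <= net n (F i) + (e / 2 ^+ (pickle i).+1)%:E)%E].
  by move=> i; apply: net_approx; rewrite divr_gt0// exprn_gt0.
apply: (le_trans (net_family (I := I `*`` S) (f := snd) _ _)) => [x [i Ii]|[i c]|].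
- by have [+ _ _] := SP i => /[apply] -[c Sc xc]; exists (i, c).
- by move=> [_ /=]; have [_ + _] := SP i; apply.
rewrite -(esum_esum (a := fun i c => (q ^+ c.1)%:E))//.
apply: (@le_trans _ _ (\esum_(i in I) (net n (F i) + (e / 2 ^+ (pickle i).+1)%:E)%E)).
  by apply: le_esum => i _; have [] := SP i.
rewrite esumD => [|i _|i _]; [|exact: net_ge0|].
  by rewrite leeD2l// esum_geometric// ltW.
by rewrite lee_fin divr_ge0 ?exprn_ge0// ltW.
Qed.

Lemma net_null_bigcup (T : countType) (I : set T) n (F : T -> set 'rV[R]_m) :
  (forall i, I i -> net n (F i) = 0%E) -> net n (\bigcup_(i in I) F i) = 0%E.
Proof.
move=> F0; apply/le_anti; rewrite net_ge0 andbT.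
by apply: le_trans (net_bigcup I n F) _; rewrite esum1.
Qed.

Lemma net_set0 n : net n set0 = 0%E.
Proof.
apply/le_anti; rewrite net_ge0 andbT -(esum_set0 (fun c : cell => (q ^+ c.1)%:E)).
exact: net_le.
Qed.

(** Pulling back a cover along [h] is how all the scaling and covering estimates
    below are obtained. *)
Lemma net_transfer (h : 'rV[R]_m -> 'rV[R]_m) (K : R) n k X Y : 0 < K ->
  (forall c, (n <= c.1)%N -> (net k (Y `&` h @^-1` cube c) <= (K * q ^+ c.1)%:E)%E) ->
  Y `<=` h @^-1` X -> (net k Y <= K%:E * net n X)%E.
Proof.
move=> K0 Hc YX; rewrite -lee_pdivrMl//; apply: net_ge => S XS Sn.
rewrite lee_pdivrMl//.
have -> : Y = \bigcup_(c in S) (Y `&` h @^-1` cube c).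
  apply/seteqP; split=> [y Yy|y [c _ []]//].
  by have [c Sc hc] := XS _ (YX _ Yy); exists c.
apply: le_trans (net_bigcup _ _ _) _.
apply: (@le_trans _ _ (\esum_(c in S) (K%:E * (q ^+ c.1)%:E))%E).
  by apply: le_esum => c Sc; rewrite -EFinM; apply/Hc/Sn.
by apply: le_esumZ => //; exact: ltW.
Qed.

Lemma net_null_transfer (h : 'rV[R]_m -> 'rV[R]_m) (K : R) n k X Y : 0 < K ->
  (forall c, (n <= c.1)%N -> (net k (Y `&` h @^-1` cube c) <= (K * q ^+ c.1)%:E)%E) ->
  Y `<=` h @^-1` X -> net n X = 0%E -> net k Y = 0%E.
Proof.
move=> K0 Hc YX X0; apply/le_anti; rewrite net_ge0 andbT.
by have := net_transfer K0 Hc YX; rewrite X0 mule0.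
Qed.

(** The similarity that maps the cell [(k, l)] onto the unit cell at the origin. *)
Definition zoom k (l : 'rV[int]_m) x : 'rV[R]_m := 2 ^+ k *: x - map_mx intr l.

Lemma cell_of_zoom n k l x :
  cell_of n (zoom k l x) = cell_of (n + k) x - 2 ^+ n *: l.
Proof.
apply/rowP => i; rewrite !mxE.
have -> : 2 ^+ n * (2 ^+ k * x 0 i - (l 0 i)%:~R) =
    2 ^+ (n + k) * x 0 i + (- (2 ^+ n * l 0 i))%:~R :> R.
  by rewrite exprD rmorphN rmorphM rmorphXn/=; ring.
by rewrite floorDrz ?intr_int// intrKfloor.
Qed.

Lemma net_zoom_le n k l X Y : Y `<=` zoom k l @^-1` X ->
  (net (n + k) Y <= (q ^+ k)%:E * net n X)%E.
Proof.
apply: net_transfer => [|c nc]; first exact: exprn_gt0.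
apply: (@le_trans _ _ (net (n + k) (cube ((c.1 + k)%N, c.2 + 2 ^+ c.1 *: l)))).
  apply: le_net => x [_]; rewrite /cube/= cell_of_zoom => <-.
  by rewrite subrK.
rewrite mulrC -exprD.
by apply: (net_cube (c := ((c.1 + k)%N, _))); rewrite leq_add2r.
Qed.

Lemma net_zoom_ge n k l X Y : zoom k l @^-1` X `<=` Y ->
  ((q ^+ k)%:E * net n X <= net (n + k) Y)%E.
Proof.
move=> XY; have qk0 : 0 < q ^+ k by exact: exprn_gt0.
rewrite -lee_pdivlMl//; pose h x : 'rV[R]_m := 2 ^- k *: (x + map_mx intr l).
have hK x : zoom k l (h x) = x.
  by rewrite /zoom /h scalerA divff ?expf_neq0// scale1r addrK.
apply: (@net_transfer h) => [|c nkc|x Xx]; first by rewrite invr_gt0.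
  have kc : (k <= c.1)%N := leq_trans (leq_addl _ _) nkc.
  apply: (@le_trans _ _ (net n (cube ((c.1 - k)%N, c.2 - 2 ^+ (c.1 - k) *: l)))).
    apply: le_net => x [_]; rewrite /cube/= => <-.
    by rewrite -{1}[x]hK cell_of_zoom subnK.
  rewrite mulrC -exprB ?unitfE ?gt_eqF//.
  by apply: (net_cube (c := ((c.1 - k)%N, _))); rewrite leq_subRL// addnC.
by apply: XY; rewrite /= hK.
Qed.

(** In each coordinate a set of diameter at most [2 ^- k] meets at most three
    consecutive dyadic intervals of length [2 ^- k]. *)
Lemma net_small n k X : (n <= k)%N ->
  (forall x y, X x -> X y -> forall i, `|x 0 i - y 0 i| <= 2 ^- k) ->
  (net n X <= ((3 ^ m)%:R * q ^+ k)%:E)%E.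
Proof.
move=> nk Xk; have [->|/set0P[x Xx]] := eqVneq X set0.
  by rewrite net_set0 lee_fin mulr_ge0 ?exprn_ge0 ?ler0n// ltW.
have -> : (3 ^ m)%:R = #|{ffun 'I_m -> 'I_3}|%:R :> R.
  by rewrite card_ffun !card_ord.
pose f (b : {ffun 'I_m -> 'I_3}) : cell :=
  (k, \row_i (cell_of k x 0 i + (b i)%:Z - 1)).
apply: (@net_finType _ f) => // y Xy.
pose j i := Num.floor (2 ^+ k * y 0 i) - (cell_of k x 0 i - 1).
have jP i : 0 <= j i < 3.
  have : - 1 <= 2 ^+ k * y 0 i - 2 ^+ k * x 0 i <= 1.
    rewrite -ler_norml -mulrBr normrM ger0_norm ?exprn_ge0//.
    rewrite mulrC -ler_pdivlMr ?exprn_gt0//.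
    by rewrite mul1r; exact: Xk.
  move=> /andP[l1 l2].
  have /andP[f1 f2] := floor_itv (2 ^+ k * y 0 i).
  have /andP[g1 g2] := floor_itv (2 ^+ k * x 0 i).
  rewrite /j mxE; move: f1 f2 g1 g2.
  set a := Num.floor _; set b := Num.floor _ => f1 f2 g1 g2.
  have h1 : (b - 1 < a + 1)%R.
    by rewrite -(ltr_int R) intrB; lra.
  have h2 : (a < b + 2)%R.
    by rewrite -(ltr_int R) intrD; move: g2; rewrite intrD; lra.
  by apply/andP; split; lia.
exists [ffun i => inord `|j i|%N] => //; rewrite /cube/=; apply/rowP => i.
have /andP[j0 j3] := jP i.
rewrite !mxE ffunE inordK; last by lia.
by rewrite gez0_abs// /j mxE; ring.
Qed.

(** A union of cells of level [k] is separated from its complement by every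
    cover whose cells have level at least [k]. *)
Lemma net_split (B : set 'rV[R]_m) k n X : (k <= n)%N ->
  (forall x y, cell_of k x = cell_of k y -> B x -> B y) ->
  (net n (X `&` B) + net n (X `&` ~` B) <= net n X)%E.
Proof.
move=> kn Bsat; apply: net_ge => S XS Sn.
pose SB := [set c : cell | exists2 x, cube c x & B x].
rewrite (esumID SB)//; apply: leeD; apply: net_le => [x [/XS[c Sc cx] Bx]|c []].
- by exists c => //; split=> //; exists x.
- by move=> /Sn.
- exists c => //; split=> // -[y cy By]; apply: Bx; apply: Bsat By.
  by apply: (cell_of_le (leq_trans kn (Sn _ Sc))); rewrite cx cy.
- by move=> /Sn.
Qed.

Lemma net_split_sum k n X (s : seq 'rV[int]_m) : (k <= n)%N -> uniq s ->
  (\sum_(l <- s) net n (X `&` cube (k, l)) <= net n X)%E.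
Proof.
move=> kn; elim: s X => [|l s IHs] X; first by rewrite big_nil net_ge0.
rewrite /= big_cons => /andP[ls us].
apply: le_trans (net_split (B := cube (k, l)) X kn _); last first.
  by move=> x y; rewrite /cube/= => ->.
apply: leeD2l; apply: le_trans (IHs _ us); rewrite big_seq [leRHS]big_seq.
apply: lee_sum => j js; apply: le_net => x [Xx xj]; split=> //; split=> //.
by rewrite /cube/= => xl; move: xj ls; rewrite /cube/= xl => ->; rewrite js.
Qed.

End Net.

(** * Hausdorff measure and net measure *)

Lemma exists_exp_lt (R : realType) (q e : R) : 0 <= q < 1 -> 0 < e ->
  exists n, q ^+ n < e.
Proof.
move=> /andP[q0 q1] e0; have qn : `|q| < 1 by rewrite ger0_norm.
have /cvgr0Pnorm_lt/(_ e e0)[n _ /(_ n (leqnn n))] := cvg_expr qn.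
by exists n; apply: le_lt_trans (ler_norm _) _.
Qed.

Section Enorm.
Context {R : realType} {d : nat}.
Implicit Types (x y : 'rV[R]_d) (U : set 'rV[R]_d).

Lemma enorm_coord x i : `|x 0 i| <= enorm x.
Proof.
rewrite -sqrtr_sqr ler_sqrt ?sumr_ge0// => [|j _]; last exact: sqr_ge0.
by rewrite (bigD1 i)//= lerDl sumr_ge0// => j _; exact: sqr_ge0.
Qed.

Lemma enorm_le_sum x : enorm x <= \sum_i `|x 0 i|.
Proof.
have s0 : 0 <= \sum_i `|x 0 i| by exact: sumr_ge0.
rewrite -[leRHS]ger0_norm// -sqrtr_sqr ler_sqrt ?sqr_ge0//.
rewrite [leRHS]expr2 mulr_suml; apply: ler_sum => i _.
rewrite -real_normK ?num_real// expr2 ler_wpM2l//.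
by rewrite (bigD1 i)//= lerDl sumr_ge0.
Qed.

Lemma le_diam U x y : U x -> U y -> ((enorm (x - y))%:E <= diam U)%E.
Proof.
move=> Ux Uy; rewrite /diam le_max; apply/orP; right.
by apply: ereal_sup_ubound; exists x => //; exists y.
Qed.

Lemma diam_ge0 U : (0 <= diam U)%E.
Proof. by rewrite /diam le_max lexx. Qed.

Lemma diam_le U (r : R) : 0 <= r -> (forall x y, U x -> U y -> enorm (x - y) <= r) ->
  (diam U <= r%:E)%E.
Proof.
move=> r0 Ur; rewrite /diam ge_max lee_fin r0/=; apply: ge_ereal_sup.
by move=> _ [x Ux [y Uy] <-]; rewrite lee_fin; exact: Ur.
Qed.

Lemma diam_pow_le (s : R) U (r : R) : 0 <= s -> 0 <= r ->
  (forall x y, U x -> U y -> enorm (x - y) <= r) ->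
  (diam_pow s U <= (r `^ s)%:E)%E.
Proof.
move=> s0 r0 Ur; rewrite /diam_pow; case: ifP => _; first by rewrite lee_fin powR_ge0.
rewrite -poweR_EFin gt0_ler_poweR ?in_itv/= ?leey ?lee_fin ?andbT ?diam_ge0//.
exact: diam_le.
Qed.

Lemma diam_pow_ge0 (s : R) U : (0 <= diam_pow s U)%E.
Proof. by rewrite /diam_pow; case: ifP => // _; exact: poweR_ge0. Qed.

Lemma hausdorff_premeasure_ge0 (s delta : R) U : (0 <= hausdorff_premeasure s delta U)%E.
Proof.
apply: le_ereal_inf_tmp => _ [V _ <-]; apply: nneseries_ge0 => i _ _.
exact: diam_pow_ge0.
Qed.

Lemma hausdorff_premeasure_le_measure (s delta : R) U : 0 < delta ->
  (hausdorff_premeasure s delta U <= hausdorff_measure s U)%E.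
Proof. by move=> d0; apply: ereal_sup_ubound; exists delta. Qed.

Lemma hausdorff_measure_ge0 (s : R) U : (0 <= hausdorff_measure s U)%E.
Proof.
apply: le_trans (hausdorff_premeasure_le_measure s U ltr01).
exact: hausdorff_premeasure_ge0.
Qed.

End Enorm.

Lemma mulmx_coord_le (R : realType) (m d : nat) (P : 'M[R]_(m, d)) (w : 'rV[R]_m)
    (r : R) j : (forall i, `|w 0 i| <= r) -> `|(w *m P) 0 j| <= r * \sum_i `|P i j|.
Proof.
move=> wr; rewrite mxE (le_trans (ler_norm_sum _ _ _))// mulr_sumr.
by apply: ler_sum => i _; rewrite normrM ler_wpM2r.
Qed.

Lemma exists_mulmx_bound (R : realType) (m d : nat) (P : 'M[R]_(m, d)) :
  exists2 K : R, 0 < K & forall (w : 'rV[R]_m) (r : R), 0 <= r ->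
    (forall i, `|w 0 i| <= r) -> forall j, `|(w *m P) 0 j| <= r * K.
Proof.
exists (1 + \sum_j \sum_i `|P i j|).
  by rewrite ltr_wpDr//; apply: sumr_ge0 => j _; exact: sumr_ge0.
move=> w r r0 wr j; apply: le_trans (mulmx_coord_le _ _ wr) _; apply: ler_wpM2l => //.
apply: (@le_trans _ _ (\sum_j \sum_i `|P i j|)); last by rewrite lerDr.
by rewrite [leRHS](bigD1 j)//= lerDl; apply: sumr_ge0 => *; exact: sumr_ge0.
Qed.

Section Compare.
Context {R : realType} {m d : nat} (s : R).
Hypothesis s_gt0 : 0 < s.
Implicit Types (F : set 'rV[R]_m) (E : set 'rV[R]_d).

(** The side [2 ^- n] of a cell of level [n], raised to the power [t], is the
    [n]-th power of this ratio. *)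
Definition half_pow (t : R) : R := 2^-1 `^ t.

Local Notation q := (half_pow s).

Lemma half_pow_gt0 t : 0 < half_pow t.
Proof. by rewrite powR_gt0. Qed.

Lemma half_pow_lt1 : q < 1.
Proof.
have -> : 1 = 1 `^ s :> R by rewrite powR1.
by rewrite gt0_ltr_powR ?nnegrE// invf_lt1// ltr1n.
Qed.

Lemma powR_half t n : (2 ^- n) `^ t = half_pow t ^+ n.
Proof.
have -> : 2 ^- n = 2^-1 `^ n%:R :> R by rewrite powR_mulrn// exprVn.
by rewrite -powRrM mulrC powRrM powR_mulrn// powR_ge0.
Qed.

Variables (p0 : 'rV[R]_d) (P : 'M[R]_(m, d)).

(** The cells of a cover of small total cost are small, so their images form an
    admissible cover for any given bound on the diameters. *)
Lemma hausdorff_null_of_net F E : (forall y, E y -> exists2 u, F u & y = p0 + u *m P) ->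
  net q 0 F = 0%E -> hausdorff_measure s E = 0%E.
Proof.
move=> EF F0; apply/le_anti; rewrite hausdorff_measure_ge0 andbT.
apply: ge_ereal_sup => _ [delta delta0 <-].
apply/lee_addgt0Pr => e e0; rewrite add0e.
pose L := 1 + \sum_j \sum_i `|P i j|.
have L0 : 0 < L.
  by rewrite ltr_wpDr//; apply: sumr_ge0 => j _; exact: sumr_ge0.
have q01 : 0 <= q < 1 by rewrite ltW ?half_pow_gt0// half_pow_lt1.
have [N HN] : exists N, 2^-1 ^+ N < delta / L.
  by apply: exists_exp_lt; rewrite ?divr_gt0//; apply/andP; split; lra.
(* A cell of cost at most [q ^ N] has level at least [N], hence an image of
   diameter at most [delta]; [L] bounds the dilatation of the affine map. *)
pose eta := Num.min (e / L `^ s) (q ^+ N).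
have eta0 : 0 < eta.
  by rewrite lt_min divr_gt0 ?powR_gt0// exprn_gt0// half_pow_gt0.
have [S [FS _ Seta]] := net_approx (half_pow_gt0 s) 0 F eta0.
rewrite F0 add0e in Seta.
have w0 (c : cell (m := m)) : (0 <= (q ^+ c.1)%:E)%E.
  by rewrite lee_fin exprn_ge0// ltW// half_pow_gt0.
have SN c : S c -> (N <= c.1)%N.
  move=> Sc; have : ((q ^+ c.1)%:E <= eta%:E)%E.
    apply: le_trans Seta; rewrite -(esum_set1 (t := c) (a := fun c : cell => (q ^+ c.1)%:E))//.
    by apply: le_esum_subset => // _ ->.
  rewrite lee_fin /eta le_min => /andP[_].
  by rewrite ler_iXn2l ?half_pow_gt0 ?half_pow_lt1.
pose U i : set 'rV[R]_d := [set y | exists2 c, S c /\ pickle c = i &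
  exists2 u, cube c u & y = p0 + u *m P].
have Udiam (c : @cell m) y z : U (pickle c) y -> U (pickle c) z ->
    enorm (y - z) <= L * 2 ^- c.1.
  move=> [c1 [_ e1] [u cu ->]].
  move=> [c2 [_ e2] [v cv ->]].
  move: cu cv; rewrite (pcan_inj pickleK e1) (pcan_inj pickleK e2) => cu cv.
  rewrite opprD addrACA subrr add0r -mulmxBl (le_trans (enorm_le_sum _))//.
  apply: (@le_trans _ _ (\sum_j 2 ^- c.1 * \sum_i `|P i j|)).
    apply: ler_sum => j _; apply: mulmx_coord_le => i; rewrite !mxE.
    exact: cube_coord_le.
  rewrite -mulr_sumr mulrC ler_pM2r ?invr_gt0 ?exprn_gt0//.
  by rewrite /L lerDr.
apply: ge_ereal_inf; exists (\sum_(0 <= i <oo) diam_pow s (U i))%E.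
  exists U => //; split=> [y /EF[u Fu ->]|i].
    have [c Sc cu] := FS _ Fu; exists (pickle c) => //.
    by exists c => //; exists u.
  have [->|/set0P[y [c [Sc <-] _]]] := eqVneq (U i) set0.
    by apply: diam_le => //; exact: ltW.
  apply: diam_le => [|y' z' Uy Uz]; first exact: ltW.
  apply: le_trans (Udiam _ _ _ Uy Uz) _.
  rewrite mulrC -ler_pdivlMr//; apply: ltW; apply: le_lt_trans HN.
  by rewrite exprVn lef_pV2 ?posrE ?exprn_gt0// ler_eXn2l ?ltr1n// SN.
rewrite nneseries_esumT; last by move=> i; exact: diam_pow_ge0.
have Us c : S c -> (diam_pow s (U (pickle c)) <= (L `^ s)%:E * (q ^+ c.1)%:E)%E.
  move=> Sc; rewrite -EFinM -powR_half -powRM ?invr_ge0 ?exprn_ge0//; last exact: ltW.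
  apply: diam_pow_le; [exact: ltW| |exact: Udiam].
  by rewrite mulr_ge0 ?invr_ge0 ?exprn_ge0// ltW.
rewrite (esumID (pickle @` S)); last by move=> i _; exact: diam_pow_ge0.
rewrite [X in (_ + X)%E]esum1 ?adde0; last first.
  move=> i [_ Si]; rewrite /diam_pow; case: eqP => // /eqP/set0P[y [c [Sc ci] _]].
  by exfalso; apply: Si; exists c.
rewrite setTI esum_image; last by move=> c1 c2 _ _; exact: (pcan_inj pickleK).
apply: (@le_trans _ _ (\esum_(c in S) ((L `^ s)%:E * (q ^+ c.1)%:E))%E).
  exact: le_esum.
apply: le_trans (le_esumZ _ (powR_ge0 _ _) w0) _.
rewrite -lee_pdivlMl ?powR_gt0//; apply: le_trans Seta _.
by rewrite -EFinM lee_fin mulrC ge_min lexx.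
Qed.

Lemma exists_half_exp_le n (r : R) : 0 < r <= 2 ^- n ->
  exists2 k, (n <= k)%N & 2 ^- k.+1 <= r <= 2 ^- k.
Proof.
move=> /andP[r0 rn].
have [k0 hk0] : exists k, 2^-1 ^+ k < r.
  by apply: exists_exp_lt => //; apply/andP; split; lra.
have ex : exists k, (n <= k)%N && (2 ^- k.+1 <= r).
  exists (maxn n k0); rewrite leq_maxl/= (le_trans _ (ltW hk0))// exprVn.
  by rewrite lef_pV2 ?posrE ?exprn_gt0// ler_eXn2l ?ltr1n// ltnW// ltnS leq_maxr.
case: (ex_minnP ex) => k /andP[nk kr] kmin; exists k => //; rewrite kr/=.
move: nk; rewrite leq_eqVlt => /orP[/eqP<-//|nk].
rewrite leNgt; apply/negP => rk; have k_gt0 : (0 < k)%N := leq_ltn_trans (leq0n _) nk.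
have := kmin k.-1; rewrite prednK// ltW// andbT -ltnS prednK// nk => /(_ isT).
by rewrite leqNgt -[X in (_ < X)%N](prednK k_gt0) leqnn.
Qed.

Variable Q : 'M[R]_(d, m).
Hypothesis PQ : P *m Q = 1%:M.

(** A set of diameter [D] lies in boundedly many cells of side comparable to [D],
    and a bound on the diameters keeps these cells beyond any given level [n]. *)
Lemma net_le_hausdorff : exists2 C : R, 0 < C & forall F E n,
  (forall u, F u -> E (p0 + u *m P)) ->
  (net q n F <= C%:E * hausdorff_measure s E)%E.
Proof.
have [K K0 QK] := exists_mulmx_bound Q.
exists ((3 ^ m)%:R * (2 * K) `^ s).
  by rewrite mulr_gt0 ?ltr0n ?expn_gt0// powR_gt0// mulr_gt0.
set C := _ * _ => F E n FE.
have C0 : 0 < C by rewrite mulr_gt0 ?ltr0n ?expn_gt0// powR_gt0// mulr_gt0.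
pose delta := 2 ^- n / K.
have delta0 : 0 < delta by rewrite divr_gt0// invr_gt0 exprn_gt0.
apply: (@le_trans _ _ (C%:E * hausdorff_premeasure s delta E)%E); last first.
  by rewrite lee_pmul2l// hausdorff_premeasure_le_measure.
rewrite -lee_pdivrMl//; apply: le_ereal_inf_tmp => _ [U [EU Udelta] <-].
rewrite lee_pdivrMl//.
pose V i := [set u : 'rV[R]_m | U i (p0 + u *m P)].
have Vcoord i u v j : V i u -> V i v ->
    `|u 0 j - v 0 j| <= enorm ((p0 + u *m P) - (p0 + v *m P)) * K.
  move=> _ _; set x := (p0 + u *m P) - _.
  have -> : u 0 j - v 0 j = (x *m Q) 0 j.
    have -> : x = (u - v) *m P by rewrite /x opprD addrACA subrr add0r mulmxBl.
    by rewrite -mulmxA PQ mulmx1 !mxE.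
  by apply: QK; [rewrite sqrtr_ge0|exact: enorm_coord].
have VC i : (net q n (V i) <= C%:E * diam_pow s (U i))%E.
  rewrite /diam_pow; case: eqP => [Ui0|/eqP/set0P[y0 Uy0]].
    rewrite mule0 (_ : V i = set0) ?net_set0 ?half_pow_gt0//.
    by apply/seteqP; split=> // u; rewrite /V/= Ui0.
  have D0 := diam_ge0 (U i); have Dd := Udelta i.
  have [D DE] : exists D, diam (U i) = D%:E.
    exists (fine (diam (U i))); rewrite fineK// ge0_fin_numE//.
    by rewrite (le_lt_trans Dd)// ltry.
  rewrite DE !lee_fin in D0 Dd *; rewrite poweR_EFin -EFinM.
  have VD u v j : V i u -> V i v -> `|u 0 j - v 0 j| <= D * K.
    move=> Vu Vv; apply: (le_trans (Vcoord i u v j Vu Vv)).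
    by rewrite ler_pM2r// -lee_fin -DE le_diam.
  move: D0; rewrite le_eqVlt => /predU1P[D0|D0].
    (* A set of diameter 0 costs nothing, but it is covered by cells of
       arbitrarily small cost. *)
    apply/lee_addgt0Pr => e e0.
    have [k hk] : exists k, q ^+ k < e / (3 ^ m)%:R.
      apply: exists_exp_lt; first by rewrite ltW ?half_pow_gt0// half_pow_lt1.
      by rewrite divr_gt0// ltr0n expn_gt0.
    have qk : q ^+ maxn n k <= q ^+ k.
      by rewrite ler_wiXn2l ?leq_maxr ?ltW ?half_pow_gt0 ?half_pow_lt1.
    apply: (@le_trans _ _ ((3 ^ m)%:R * q ^+ maxn n k)%:E).
      apply: net_small; [exact: half_pow_gt0|exact: leq_maxl|].
      move=> u v Vu Vv j; apply: (le_trans (VD u v j Vu Vv)).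
      by rewrite -D0 mul0r invr_ge0 exprn_ge0.
    rewrite -EFinD lee_fin -D0 powR0 ?gt_eqF// mulr0 add0r.
    rewrite mulrC -ler_pdivlMr ?ltr0n ?expn_gt0//.
    by rewrite (le_trans qk)// ltW.
  have [k nk /andP[k1 k2]] : exists2 k, (n <= k)%N & 2 ^- k.+1 <= D * K <= 2 ^- k.
    by apply: exists_half_exp_le; rewrite mulr_gt0//= -ler_pdivlMr.
  apply: (@le_trans _ _ ((3 ^ m)%:R * q ^+ k)%:E).
    apply: net_small => //; first exact: half_pow_gt0.
    by move=> u v Vu Vv j; rewrite (le_trans (VD u v j Vu Vv)).
  rewrite lee_fin /C -mulrA ler_pM2l ?ltr0n ?expn_gt0//.
  have [K0' D0'] := (ltW K0, ltW D0).
  rewrite -powR_half -powRM ?mulr_ge0//.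
  rewrite ge0_ler_powR ?nnegrE ?mulr_ge0 ?invr_ge0 ?exprn_ge0// ?(ltW s_gt0)//.
  have : 2 ^- k = 2 * 2 ^- k.+1 :> R.
    by rewrite exprS invfM mulrA divff ?mul1r.
  by move=> ->; rewrite -mulrA ler_pM2l// mulrC.
apply: (@le_trans _ _ (net q n (\bigcup_i V i))).
  apply: le_net.
  by move=> u /FE/EU[i _ Ui]; exists i.
apply: le_trans (net_bigcup (half_pow_gt0 s) _ _ _) _.
rewrite nneseries_esumT; last by move=> i; exact: diam_pow_ge0.
apply: (@le_trans _ _ (\esum_(i in setT) (C%:E * diam_pow s (U i)))%E).
  by apply: le_esum => i _; exact: VC.
apply: le_esumZ; first exact: ltW.
by move=> i; exact: diam_pow_ge0.
Qed.

End Compare.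

(** * Midpoint convex sets and dyadic lattices *)

Section Midpoint.
Context {R : realType} {m : nat}.
Implicit Types (F X : set 'rV[R]_m).

Lemma midpoint_seq F k (s : seq 'rV[R]_m) : midpoint_convex F ->
  size s = (2 ^ k)%N -> (forall x, x \in s -> F x) ->
  F (2 ^- k *: \sum_(x <- s) x).
Proof.
move=> Fmid; elim: k s => [|k IHk] s ss Fs.
  case: s ss Fs => [|x [|//]]// _ Fx; rewrite big_seq1 expr0 invr1 scale1r.
  by apply: Fx; rewrite inE.
rewrite -(cat_take_drop (2 ^ k) s) big_cat/= exprS invfM -scalerA scalerDr.
have sle : (2 ^ k <= size s)%N by rewrite ss leq_exp2l.
apply: Fmid; apply: IHk.
- by rewrite size_takel.
- by move=> x /mem_take; exact: Fs.
- by rewrite size_drop ss expnS mul2n -addnn addnK.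
- by move=> x /mem_drop; exact: Fs.
Qed.

(** The [2 ^ k]-fold means of points of [F] contain a scaled copy of [F]
    translated along a large piece of the lattice of mesh [2 ^- k]. *)
Lemma midpoint_lattice F k (a : 'rV[R]_m) (l : 'I_m -> nat) : midpoint_convex F ->
  F 0 -> (forall i, F (delta_mx 0 i)) -> F a -> (\sum_i l i < 2 ^ k)%N ->
  F (2 ^- k *: (a + \row_i (l i)%:R)).
Proof.
move=> Fmid F0 Fe Fa lk.
pose e (i : 'I_m) : 'rV[R]_m := delta_mx 0 i.
pose s := a :: nseq (2 ^ k - (\sum_i l i).+1) 0 ++
  flatten [seq nseq (l i) (e i) | i <- index_enum 'I_m].
have -> : a + \row_i (l i)%:R = \sum_(x <- s) x.
  rewrite big_cons big_cat/= [X in _ + (X + _)]big1_seq ?add0r => [|x]; last first.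
    by rewrite mem_nseq => /andP[_ /andP[_ /eqP]].
  rewrite big_flatten/= big_map [X in _ + X]row_sum_delta; congr (_ + _).
  apply: eq_bigr => i _; rewrite mxE big_nseq -/(e i).
  by elim: (l i) => [|n IHn]; rewrite ?scale0r//= -IHn -natr1 scalerDl scale1r addrC.
apply: midpoint_seq => //.
  rewrite /= size_cat size_nseq size_flatten /shape -map_comp sumnE big_map.
  under [X in (_ + X)%N]eq_bigr do rewrite /= size_nseq.
  by rewrite -addSn -subSn// subSS subnK// ltnW.
move=> x; rewrite inE => /predU1P[->//|].
rewrite mem_cat => /orP[|/flattenP[t /mapP[i _ ->]]]; rewrite mem_nseq => /andP[_ /eqP->]//.
Qed.

Variable q : R.
Hypothesis q0 : 0 < q.

Lemma cube_subdivide k (c : @cell m) :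
  cube (R := R) c `<=` \bigcup_(b in [set: {ffun 'I_m -> 'I_(2 ^ k)}])
    cube ((c.1 + k)%N, 2 ^+ k *: c.2 + \row_i (b i)%:Z).
Proof.
move=> x cx; pose j i : int := cell_of (c.1 + k) x 0 i - 2 ^+ k * c.2 0 i.
have jP i : 0 <= j i < 2 ^+ k.
  have /cell_ofP/(_ i)/andP[h1 h2] := cx.
  have xE : 2 ^+ (c.1 + k) * x 0 i = 2 ^+ k * (2 ^+ c.1 * x 0 i) by rewrite exprD; ring.
  rewrite /j mxE subr_ge0 floor_ge_int ltrBlDl floor_lt_int xE.
  rewrite intrD intrM rmorphXn/= ler_pM2l ?exprn_gt0// h1/=.
  by rewrite -[X in _ < _ + X]mulr1 -mulrDr ltr_pM2l ?exprn_gt0// -intrD1.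
have jE i : `|j i|%N%:Z = j i by rewrite gez0_abs//; case/andP: (jP i).
have jlt i : (`|j i| < 2 ^ k)%N.
  by rewrite -ltz_nat jE -natz natrX; case/andP: (jP i).
exists [ffun i => Ordinal (jlt i)] => //; rewrite /cube/=; apply/rowP => i.
by rewrite !mxE ffunE jE /j mxE addrC subrK.
Qed.

Lemma net_cube_le n k (c : @cell m) : (n <= c.1 + k)%N ->
  (net q n (cube c) <= (((2 ^+ m) * q) ^+ k * q ^+ c.1)%:E)%E.
Proof.
move=> nk.
apply: (le_trans (net_finType q0 (@cube_subdivide k c) (k := (c.1 + k)%N) _ nk)) => //.
rewrite lee_fin card_ffun !card_ord !natrX.
have -> : (2 ^+ k) ^+ m * q ^+ (c.1 + k) = (2 ^+ m * q) ^+ k * q ^+ c.1 :> R; last by [].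
by rewrite exprMn -!exprM mulnC exprD; ring.
Qed.

Lemma net_null_of_lt1 : 2 ^+ m * q < 1 -> net q 0 [set: 'rV[R]_m] = 0%E.
Proof.
move=> mq1; rewrite (_ : [set: _] = \bigcup_(j in [set: 'rV[int]_m]) cube (0%N, j)); last first.
  by apply/seteqP; split=> // x _; exists (cell_of 0 x).
apply: net_null_bigcup => // j _; apply/le_anti; rewrite net_ge0// andbT.
apply/lee_addgt0Pr => e e0; rewrite add0e.
have mq0 : 0 < 2 ^+ m * q by rewrite mulr_gt0// exprn_gt0.
have [k ke] : exists k, (2 ^+ m * q) ^+ k < e by apply: exists_exp_lt; rewrite ?ltW.
apply: (le_trans (net_cube_le (n := 0) (k := k) _)) => //.
by rewrite lee_fin expr0 mulr1 ltW.
Qed.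

Lemma exists_net_cube F n : net q n F != 0%E ->
  exists j, net q n (F `&` cube (0%N, j)) != 0%E.
Proof.
move=> F0; apply: contrapT => H; case/eqP: F0.
have -> : F = \bigcup_(j in [set: 'rV[int]_m]) (F `&` cube (0%N, j)).
  by apply/seteqP; split=> [x Fx|x [j _ []]//]; exists (cell_of 0 x).
apply: net_null_bigcup => // j _; apply/eqP; apply: contrapT => /negP Hj.
by apply: H; exists j.
Qed.

(** At level [k] the set [F] contains about [2 ^ (k * m)] copies, scaled by
    [2 ^- k], of a part of [F] lying in a unit cell, and they lie in distinct
    cells; each of them carries the fraction [q ^ k] of the content of that part. *)
Lemma net_unbounded F : midpoint_convex F -> F 0 -> (forall i, F (delta_mx 0 i)) ->
  1 < 2 ^+ m * q -> net q 0 F != 0%E ->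
  forall B : R, exists k, (B%:E <= net q k F)%E.
Proof.
move=> Fmid F0 Fe mq1 /exists_net_cube[j]; set A := F `&` _ => A0 B.
have [v v0 vA] : exists2 v : R, 0 < v & (v%:E <= net q 0 A)%E.
  have := net_ge0 q0 0 A; rewrite le_eqVlt eq_sym (negPf A0)/=.
  case: (net q 0 A) => [r|_|//]; first by rewrite lte_fin => r0; exists r.
  by exists 1; rewrite ?leey.
have qm0 : 0 < q ^+ m * v by rewrite mulr_gt0// exprn_gt0.
have [k1 hk1] : exists k, (2 ^+ m * q)^-1 ^+ k < q ^+ m * v / (1 + `|B|).
  apply: exists_exp_lt.
    by rewrite invr_ge0 (ltW (lt_trans ltr01 mq1)) invf_lt1 ?(lt_trans ltr01 mq1).
  by rewrite divr_gt0// ltr_pwDl.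
(* Lattice vectors with entries below [2 ^ k1] have coordinate sum below [2 ^ k]. *)
exists (k1 + m)%N; set k := (k1 + m)%N.
pose c (b : {ffun 'I_m -> 'I_(2 ^ k1)}) : 'rV[int]_m := j + \row_i (b i)%:Z.
have c_inj : injective c.
  move=> b1 b2 /addrI /rowP b12; apply/ffunP => i; apply/val_inj.
  by have := b12 i; rewrite !mxE => -[].
apply: le_trans (net_split_sum q0 F (s := [seq c b | b <- index_enum _])
  (leqnn k) _); last first.
  by rewrite map_inj_uniq// index_enum_uniq.
rewrite big_map.
apply: (@le_trans _ _ (\sum_(b : {ffun 'I_m -> 'I_(2 ^ k1)}) (q ^+ k * v)%:E)%E).
  rewrite sumEFin sumr_const card_ffun !card_ord lee_fin -mulr_natl natrX natrX.
  apply: (@le_trans _ _ (1 + `|B|)); first by rewrite (le_trans (ler_norm _))// lerDr.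
  have -> : (2 ^+ k1) ^+ m * (q ^+ k * v) = q ^+ m * v * (2 ^+ m * q) ^+ k1 :> R.
    by rewrite exprMn -!exprM mulnC exprD; ring.
  move: hk1; rewrite ltr_pdivlMr ?ltr_pwDl// exprVn mulrC ltr_pdivrMr.
    exact: ltW.
  by rewrite exprn_gt0 ?(lt_trans ltr01 mq1).
apply: lee_sum => b _.
apply: (@le_trans _ _ ((q ^+ k)%:E * net q 0 A)%E).
  by rewrite EFinM lee_pmul2l// lte_fin exprn_gt0.
rewrite -[X in net _ X]add0n; apply: (@net_zoom_ge R m q q0 0 k (\row_i (b i)%:Z)) => x.
move=> [Fx jx]; split; last first.
  by move: jx; rewrite /cube/= cell_of_zoom add0n expr0 scale1r /c => <-; rewrite subrK.
have := @midpoint_lattice F k _ (fun i => b i) Fmid F0 Fe Fx.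
rewrite /zoom (_ : map_mx _ _ = \row_i (b i)%:R); last first.
  by apply/rowP => i; rewrite !mxE.
rewrite subrK scalerA mulVf ?scale1r ?expf_neq0//; apply.
apply: (@leq_ltn_trans (m * (2 ^ k1 - 1))).
  rewrite -[X in (_ <= X * _)%N]card_ord -sum_nat_const; apply: leq_sum => i _.
  by rewrite leq_subRL ?expn_gt0// add1n.
rewrite /k expnD mulnC; apply: (@leq_ltn_trans ((2 ^ k1 - 1) * 2 ^ m)).
  by rewrite leq_mul2l ltnW ?orbT// ltn_expl.
by rewrite ltn_pmul2r ?expn_gt0// ltn_subrL expn_gt0.
Qed.

End Midpoint.

(** * Sets of positive content in the critical dimension *)

Section Borel.
Context {R : realType} {n : nat}.
Implicit Types A B : set 'rV[R]_n.

Lemma borel_set0 : borel_set (set0 : set 'rV[R]_n).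
Proof. exact: sigma_algebra0. Qed.

Lemma borel_setC A : borel_set A -> borel_set (~` A).
Proof. by move=> bA; rewrite -setTD; exact: sigma_algebraCD. Qed.

Lemma borel_bigcup (T : countType) (I : set T) (F : T -> set 'rV[R]_n) :
  (forall i, I i -> borel_set (F i)) -> borel_set (\bigcup_(i in I) F i).
Proof.
move=> bF; rewrite (_ : \bigcup_(i in I) F i =
    \bigcup_k (if unpickle k is Some i then if `[< I i >] then F i else set0 else set0)).
  apply: sigma_algebra_bigcup => k; case: (unpickle k) => [i|]; last exact: borel_set0.
  by case: asboolP => [/bF//|_]; exact: borel_set0.
apply/seteqP; split=> [x [i Ii Fx]|x [k _]].
  by exists (pickle i) => //; rewrite pickleK; case: asboolP.
by case: (unpickle k) => // i; case: asboolP => // Ii Fx; exists i.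
Qed.

Lemma borel_bigcap (T : countType) (I : set T) (F : T -> set 'rV[R]_n) :
  (forall i, I i -> borel_set (F i)) -> borel_set (\bigcap_(i in I) F i).
Proof.
move=> bF; rewrite -[X in borel_set X]setCK setC_bigcap; apply: borel_setC.
by apply: borel_bigcup => i /bF; exact: borel_setC.
Qed.

Lemma borel_setI A B : borel_set A -> borel_set B -> borel_set (A `&` B).
Proof.
move=> bA bB; rewrite (_ : A `&` B = \bigcap_(b in [set: bool]) (if b then A else B)).
  by apply: borel_bigcap => -[].
apply/seteqP; split=> [x [Ax Bx] [] //|x AB].
by split; [exact: (AB true)|exact: (AB false)].
Qed.

Lemma borel_coord_lt i c : borel_set [set x : 'rV[R]_n | x 0 i < c].
Proof.
apply: sub_sigma_algebra => /=.
apply: (@open_comp _ _ (fun x : 'rV[R]_n => x 0 i) [set y | y < c]).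
  by move=> x _; exact: coord_continuous.
exact: open_lt.
Qed.

Lemma borel_cube c : borel_set (cube c : set 'rV[R]_n).
Proof.
rewrite (_ : cube c = \bigcap_(i in [set: 'I_n])
   ([set x | x 0 i < (c.2 0 i + 1)%:~R / 2 ^+ c.1] `&`
    ~` [set x | x 0 i < (c.2 0 i)%:~R / 2 ^+ c.1])).
  apply: borel_bigcap => i _; apply: borel_setI; last apply: borel_setC;
    exact: borel_coord_lt.
apply/seteqP; split=> [x /cell_ofP cx i _|x cx].
  have /andP[c1 c2] := cx i; split=> /=; first by rewrite ltr_pdivlMr ?exprn_gt0// mulrC.
  by apply/negP; rewrite -leNgt ler_pdivrMr ?exprn_gt0// mulrC.
apply/cell_ofP => i; have [/= c2 /negP] := cx i Logic.I.
rewrite -leNgt ler_pdivrMr ?exprn_gt0// mulrC => ->.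
by rewrite mulrC -ltr_pdivlMr ?exprn_gt0.
Qed.

End Borel.

Lemma borel_preimage (R : realType) (m n : nat) (f : 'rV[R]_m -> 'rV[R]_n)
    (A : set 'rV[R]_n) : continuous f -> borel_set A -> borel_set (f @^-1` A).
Proof.
move=> fc; apply: (smallest_sub (X := [set B | borel_set (f @^-1` B)])).
  split.
  - by rewrite /= preimage_set0; exact: sigma_algebra0.
  - move=> B /= fB; rewrite setTD preimage_setC -setTD; exact: sigma_algebraCD.
  - by move=> B fB /=; rewrite preimage_bigcup; exact: sigma_algebra_bigcup.
move=> U oU /=; apply: sub_sigma_algebra; apply: open_comp => // x _; exact: fc.
Qed.

Section Critical.
Context {R : realType} {m : nat} (q : R).
Hypothesis q0 : 0 < q.
Hypothesis mq1 : 2 ^+ m * q = 1.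
Implicit Types (A F X : set 'rV[R]_m).

(** Splitting a cell into smaller cells does not change the total cost, so only
    covers by small cells need to be considered. *)
Lemma net_critical n X : net q n X = net q 0 X.
Proof.
apply/le_anti; rewrite [X in _ && X]net_level// andbT.
rewrite -[leRHS]mul1e; apply: (net_transfer q0 (h := id)) => // c _.
apply: (@le_trans _ _ (net q n (cube c))); first by apply: le_net => x [].
by apply: (le_trans (net_cube_le q0 (k := n) _)); rewrite ?leq_addl// mq1 expr1n.
Qed.

Lemma net_outer_measure : exists M : {outer_measure set 'rV[R]_m -> \bar R},
  M = net q 0 :> (set 'rV[R]_m -> \bar R).
Proof.
have h : sigma_subadditive (net q 0 : set 'rV[R]_m -> \bar R).
  move=> F; rewrite nneseries_esumT; last by move=> i; exact: net_ge0.
  exact: net_bigcup.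
pose h' := isOuterMeasure.Build R 'rV[R]_m (net q 0) (net_set0 q0 0)
  (net_ge0 q0 0) (fun X Y => @le_net R m q 0 X Y) h.
pose M : {outer_measure set 'rV[R]_m -> \bar R} := HB.pack (net q 0) h'.
by exists M.
Qed.

Lemma open_bigcup_cubes (U : set 'rV[R]_m) : open U ->
  U = \bigcup_(c in [set c : @cell m | cube c `<=` U]) cube c.
Proof.
move=> oU; apply/seteqP; split=> [x Ux|x [c /= cU /cU//]].
have /nbhs_ballP[e /= e0 xeU] : nbhs x U by exact: open_nbhs_nbhs.
have [n ne] : exists n, 2^-1 ^+ n < e.
  by apply: exists_exp_lt => //; apply/andP; split; lra.
exists (n, cell_of n x) => //= y cy; apply: xeU.
split=> // i j; rewrite (ord1 i) /ball/=.
by apply: le_lt_trans ne; rewrite exprVn; apply: (cube_coord_le (c := (n, cell_of n x))).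
Qed.

(** Cells satisfy the Caratheodory condition because covers may be taken at their
    own level, where they split exactly. *)
Lemma borel_caratheodory A : borel_set A ->
  caratheodory_measurable (net q 0 : set 'rV[R]_m -> \bar R) A.
Proof.
have [M ME] := net_outer_measure; rewrite -ME.
have M_bigcup (B : nat -> set 'rV[R]_m) :
    (forall n, caratheodory_measurable M (B n)) -> caratheodory_measurable M (\bigcup_n B n).
  exact: caratheodory_measurable_bigcup.
apply: smallest_sub.
  split.
  - exact: caratheodory_measurable_set0.
  - by move=> B MB; rewrite setTD; exact: caratheodory_measurable_setC.
  - exact: M_bigcup.
move=> U oU; rewrite (open_bigcup_cubes oU).
rewrite (_ : \bigcup_(c in _) _ = \bigcup_n (if unpickle n is Some c then
    (if pselect (@cube R m c `<=` U) then cube c else set0) else set0)).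
  apply: M_bigcup => n.
  case: (unpickle n) => [c|]; last exact: caratheodory_measurable_set0.
  case: (pselect (@cube R m c `<=` U)) => [?|?]; last exact: caratheodory_measurable_set0.
  apply: le_caratheodory_measurable => X; rewrite ME.
  rewrite -!(net_critical c.1); apply: (net_split q0 (k := c.1)) => // x y.
  by rewrite /cube/= => ->.
apply/seteqP; split=> [x [c cU cx]|x [n _]].
  by exists (pickle c) => //; rewrite pickleK; case: (pselect (@cube R m c `<=` U)).
case: (unpickle n) => // c.
by case: (pselect (@cube R m c `<=` U)) => // cU cx; exists c.
Qed.

Lemma zoom_zoom k k' (l l' : 'rV[int]_m) (x : 'rV[R]_m) :
  zoom k' l' (zoom k l x) = zoom (k + k') (2 ^+ k' *: l + l') x.
Proof.
apply/rowP => i; rewrite !mxE rmorphD rmorphM rmorphXn/= exprD; ring.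
Qed.

(** A zero-one law for the doubling map.  Call [M0] the set of points none of whose
    images under [x |-> 2 ^ k * x] falls into [A] modulo the integers.  The part
    of [M0] in any cell is a scaled copy of a part of its trace on the unit cell;
    hence if that trace has content [c], then covering it by cells gives
    [c <= c * c], while [c < 1] because [M0] misses [A]. *)
Lemma net_zero_one A : A `<=` cube (0%N, 0) -> borel_set A -> net q 0 A != 0%E ->
  net q 0 [set x | forall k l, ~ A (zoom k l x)] = 0%E.
Proof.
move=> AQ bA A0; set M0 := [set x | _]; set Q0 : set 'rV[R]_m := cube (0%N, 0).
have M0cube k l : (net q 0 (M0 `&` cube (k, l)) <= (q ^+ k)%:E * net q 0 (M0 `&` Q0))%E.
  apply: (@le_trans _ _ (net q (0 + k) (M0 `&` cube (k, l)))); first exact: net_level.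
  apply: (@net_zoom_le R m q q0 0 k l) => x [M0x xl]; split.
    by move=> k' l'; rewrite zoom_zoom; exact: M0x.
  by rewrite /Q0 /cube/= cell_of_zoom add0n xl expr0 scale1r subrr.
have Q01 : (net q 0 Q0 <= 1)%E by apply: le_trans (net_cube q0 _) _.
have AM : (net q 0 A + net q 0 (M0 `&` Q0) <= 1)%E.
  apply: le_trans Q01; rewrite (borel_caratheodory bA Q0); apply: leeD; apply: le_net.
    by move=> x Ax; split=> //; exact: AQ.
  move=> x [M0x Qx]; split=> // Ax; apply: (M0x 0%N 0).
  by rewrite /zoom expr0 scale1r map_mx0 subr0.
have Mfin : net q 0 (M0 `&` Q0) \is a fin_num.
  rewrite ge0_fin_numE ?net_ge0//; apply: (@le_lt_trans _ _ 1%E); last exact: ltry.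
  by apply: le_trans AM; rewrite leeDr ?net_ge0.
have [c cE] : exists c, net q 0 (M0 `&` Q0) = c%:E.
  by exists (fine (net q 0 (M0 `&` Q0))); rewrite fineK.
have c0 : 0 <= c by rewrite -lee_fin -cE net_ge0.
have c1 : c < 1.
  rewrite -lte_fin -cE; apply: (@lt_le_trans _ _ (net q 0 A + net q 0 (M0 `&` Q0))%E) => //.
  by rewrite lteDr// lt_neqAle eq_sym A0 net_ge0.
have {}c0 : c = 0.
  apply/eqP; rewrite eq_le c0 andbT leNgt; apply/negP => c_gt0.
  have : (net q 0 (M0 `&` Q0) <= c%:E * net q 0 (M0 `&` Q0))%E.
    apply: (net_transfer q0 (h := id)) => // -[k l] _.
    apply: (@le_trans _ _ (net q 0 (M0 `&` cube (k, l)))).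
      by apply: le_net => x [[]].
    by rewrite mulrC EFinM -cE; exact: M0cube.
  by rewrite cE -EFinM lee_fin leNgt -[X in _ < X]mulr1 ltr_pM2l// c1.
rewrite (_ : M0 = \bigcup_(l in [set: 'rV[int]_m]) (M0 `&` cube (0%N, l))).
  apply: net_null_bigcup => // l _; apply/le_anti; rewrite net_ge0// andbT.
  by apply: le_trans (M0cube _ _) _; rewrite cE c0 mule0.
by apply/seteqP; split=> [x Mx|x [l _ []]//]; exists (cell_of 0 x).
Qed.

End Critical.

Section CriticalInterior.
Context {R : realType} {m : nat} (q : R).
Hypothesis q0 : 0 < q.
Hypothesis mq1 : 2 ^+ m * q = 1.
Variable F : set 'rV[R]_m.
Hypotheses (Fmid : midpoint_convex F) (F0 : F 0).
Hypothesis Fe : forall i, F (delta_mx 0 i).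
Hypotheses (bF : borel_set F) (Fpos : net q 0 F != 0%E).

(** This cell lies inside the standard simplex, away from its faces. *)
Let Z : set 'rV[R]_m := cube (m.+2, const_mx 1).

Lemma exists_unit_part : exists j : 'rV[int]_m,
  let A := [set x | (F `&` cube (0%N, j)) (x + map_mx intr j)] in
  [/\ A `<=` cube (0%N, 0), borel_set A & net q 0 A != 0%E].
Proof.
have [j Aj] := exists_net_cube q0 Fpos; exists j => /=; split.
- move=> x [_]; rewrite /cube/= => xj; apply/rowP => i.
  have /rowP/(_ i) := xj; rewrite !mxE !expr0 !mul1r floorDrz ?intr_int// intrKfloor.
  by move=> h; apply: (@addIr _ (j 0 i)); rewrite add0r.
- apply: (@borel_preimage R m m (fun x => x + map_mx intr j) (F `&` cube (0%N, j))).
    move=> x; apply: (@continuousD R 'rV[R]_m 'rV[R]_m id (cst (map_mx intr j))).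
      exact: cvg_id.
    exact: cst_continuous.
  exact: borel_setI bF (borel_cube _).
- apply: contraNneq Aj => A0; apply/eqP/le_anti; rewrite net_ge0// andbT.
  have := @net_zoom_le R m q q0 0 0 j
    [set x | (F `&` cube (0%N, j)) (x + map_mx intr j)] (F `&` cube (0%N, j)).
  rewrite A0 mule0; apply=> x Fx; rewrite /= /zoom expr0 scale1r subrK.
  exact: Fx.
Qed.

(** If the image of a point [x] of [Z] under some [2 ^ K], with [K] large, is
    congruent modulo the integers to a point of the chosen part of [F], then
    [midpoint_lattice] puts [x] in [F]; the points for which this never happens
    form a null set by [net_zero_one]. *)
Lemma net_cell_setD : net q 0 (Z `\` F) = 0%E.
Proof.
have [j /= [AQ bA A0]] := exists_unit_part.
set A := [set x | _] in AQ bA A0.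
pose J := (\sum_i `|j 0%R i|)%N.
have M0 := net_zero_one q0 mq1 AQ bA A0; set M := [set x | _] in M0.
(* For [K >= k0] the lattice vector [p] below has nonnegative entries, because
   the coordinates of [x] are at least [2 ^- m.+2], and coordinate sum below
   [2 ^ K], because they are less than [2 * 2 ^- m.+2]. *)
pose k0 := (m.+2 + J)%N.
apply/le_anti; rewrite net_ge0// andbT.
apply: (@le_trans _ _ (net q (0 + k0) (Z `\` F))); first exact: net_level.
apply: (le_trans (@net_zoom_le R m q q0 0 k0 0 M (Z `\` F) _)); last by rewrite M0 mule0.
move=> x [Zx nFx] k l; rewrite zoom_zoom; set l' := _ + _.
move=> [Fa ja]; apply: nFx; move: Fa ja; set K := (k0 + k)%N; set a := _ + _ => Fa ja.
pose r := (J + k)%N; have KE : K = (m.+2 + r)%N by rewrite /K /k0 /r addnA.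
pose p i : int := l' 0 i - j 0 i.
have xE i : 2 ^+ K * x 0 i = a 0 i + (p i)%:~R.
  by rewrite /a /p /zoom !mxE intrB; ring.
have aj i : (j 0 i)%:~R <= a 0 i < (j 0 i + 1)%:~R.
  by have /cell_ofP/(_ i) := ja; rewrite expr0 mul1r.
have jJ i : (`|j 0%R i| <= J)%N by rewrite /J (bigD1 i)//= leq_addr.
have Jr : (J < 2 ^ r)%N.
  by rewrite (leq_trans (ltn_expl J (ltnSn 1)))// leq_exp2l// leq_addr.
have xr i : (2 ^ r)%:R <= 2 ^+ K * x 0 i < 2 * (2 ^ r)%:R.
  have /cell_ofP/(_ i) := Zx; rewrite mxE => /andP[x1 x2].
  have -> : 2 ^+ K * x 0 i = 2 ^+ m.+2 * x 0 i * 2 ^+ r by rewrite KE exprD; ring.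
  by rewrite natrX -{1}[2 ^+ r]mul1r ler_pM2r ?ltr_pM2r ?exprn_gt0// x1.
have pP i : 0 <= p i <= (2 ^ r.+1 + `|j 0%R i|)%N%:Z.
  have /andP[x1 x2] := xr i; have /andP[a1 a2] := aj i.
  have hJ : (`|j 0 i|)%:~R + 1 <= (2 ^ r)%:R :> R.
    have : (`|j 0%R i|%N < 2 ^ r)%N := leq_ltn_trans (jJ i) Jr.
    by rewrite -(ler_nat R) -natr1 natr_absz.
  have j1 : (j 0 i)%:~R <= (`|j 0 i|)%:~R :> R by rewrite ler_int ler_norm.
  have j2 : - (j 0 i)%:~R <= (`|j 0 i|)%:~R :> R by rewrite -rmorphN ler_int -normrN ler_norm.
  have pE : (p i)%:~R = 2 ^+ K * x 0 i - a 0 i by rewrite xE; ring.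
  move: a2; rewrite intrD => a2.
  apply/andP; split; first by rewrite -(ler_int R) pE; lra.
  rewrite -(ler_int R) pE PoszD intrD expnS abszE PoszM intrM.
  lra.
have pE i : (`|p i|%N)%:R = (p i)%:~R :> R.
  by rewrite -[in RHS](gez0_abs (proj1 (andP (pP i)))).
have -> : x = 2 ^- K *: (a + \row_i (`|p i|%N)%:R).
  apply/rowP => i; rewrite [RHS]mxE [X in _ * X]mxE [X in _ * (_ + X)]mxE pE -xE.
  by rewrite mulrA mulVf ?mul1r// expf_neq0.
apply: midpoint_lattice => //.
have m2 : (m < 2 ^ m)%N by exact: ltn_expl.
apply: (@leq_ltn_trans (m * 2 ^ r.+1 + J)).
  rewrite /J -[X in (_ <= X * _ + _)%N]card_ord -sum_nat_const -big_split/=.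
  by apply: leq_sum => i _; have := pP i; lia.
have KE' : (2 ^ K = 2 ^ m * (2 * (2 * 2 ^ r)))%N.
  by rewrite KE addSn addSn !expnS expnD; lia.
rewrite KE' expnS; nia.
Qed.

(** If [z] is near the centre of [Z], then [Z] and its reflection in [z] share the
    cell [Q].  If moreover [z] is not in [F], no point of [Q] lies in [F] together
    with its reflection, so [Q] is covered by the null set [Z] minus [F] and its
    reflection. *)
Lemma critical_interior : exists (z0 : 'rV[R]_m) (r : R), 0 < r /\
  forall z : 'rV[R]_m, (forall i, `|z 0 i - z0 0 i| <= r) -> F z.
Proof.
pose t := m.+2; exists (const_mx (3 / 2 * 2 ^- t)), (2 ^- t / 8).
have t0 : 0 < 2 ^- t :> R by rewrite invr_gt0 exprn_gt0.
split=> [|z zr]; first by rewrite divr_gt0.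
apply: contrapT => nFz.
(* The corner [6 * 2 ^- t.+2] of [Q] is the centre of [Z]. *)
pose Q : set 'rV[R]_m := cube (t.+2, const_mx 6).
pose h (x : 'rV[R]_m) := 2 *: z - x.
have QZ x : Q x -> Z x /\ Z (h x).
  move=> Qx; have {}Qx i : 3 / 2 <= 2 ^+ t * x 0 i < 7 / 4.
    have /cell_ofP/(_ i) := Qx; rewrite mxE.
    have -> : 2 ^+ t.+2 * x 0 i = 4 * (2 ^+ t * x 0 i) by rewrite !exprS; ring.
    by move=> /andP[x1 x2]; apply/andP; split; lra.
  have zt i : `|2 ^+ t * z 0 i - 3 / 2| <= 1 / 8.
    have -> : 2 ^+ t * z 0 i - 3 / 2 = 2 ^+ t * (z 0 i - 3 / 2 * 2 ^- t) :> R.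
      by rewrite mulrBr mulrCA divff ?mulr1// expf_neq0.
    rewrite normrM ger0_norm ?exprn_ge0// -ler_pdivlMl ?exprn_gt0//.
    by rewrite mul1r; have := zr i; rewrite mxE.
  split; apply/cell_ofP => i; rewrite /= !mxE -/t; have /andP[x1 x2] := Qx i.
    by apply/andP; split; lra.
  have -> : 2 ^+ t * (2 * z 0 i - x 0 i) = 2 * (2 ^+ t * z 0 i) - 2 ^+ t * x 0 i by ring.
  by have := zt i; rewrite ler_norml => /andP[z1 z2]; apply/andP; split; lra.
have QZF : Q `<=` \bigcup_(b in [set: bool])
    (if b then Z `\` F else h @^-1` (Z `\` F)).
  move=> x /QZ[Zx Zhx]; have [Fx|nFx] := pselect (F x); last by exists true.
  exists false => //; split=> // Fhx; apply: nFz.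
  have -> : z = 2^-1 *: (x + h x) by rewrite /h addrC subrK scalerA mulVf ?scale1r.
  exact: Fmid.
have ZF0 := net_cell_setD.
have Q0 : net q 0 Q = 0%E.
  apply/le_anti; rewrite net_ge0// andbT; apply: (le_trans (le_net _ _ QZF)).
  rewrite net_null_bigcup// => -[] _ //.
  apply: (@net_null_transfer R m q q0 h (3 ^ m)%:R 0 0 (Z `\` F)) => //.
  move=> c _; apply: (@le_trans _ _ (net q c.1 (h @^-1` (Z `\` F) `&` h @^-1` cube c))).
    exact: net_level.
  apply: net_small => // x y [_ hx] [_ hy] i.
  have := cube_coord_le i hx hy; rewrite /h !mxE distrC.
  by congr (_ <= _); congr `|_|; ring.
have [j /= [AQ _ /eqP]] := exists_unit_part; apply.
apply/le_anti; rewrite net_ge0// andbT; apply: (le_trans (le_net _ _ AQ)).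
have qt : 0 < q ^+ t.+2 by exact: exprn_gt0.
have : ((q ^+ t.+2)%:E * net q 0 (cube (0%N, 0%R) : set 'rV[R]_m) <= net q (0 + t.+2) Q)%E.
  apply: (@net_zoom_ge R m q q0 0 t.+2 (const_mx 6)) => x.
  rewrite /Q /cube/= cell_of_zoom add0n expr0 scale1r => /eqP.
  by rewrite subr_eq0 => /eqP.
by rewrite (net_critical q0 mq1) Q0 pmule_rle0.
Qed.

End CriticalInterior.

(** * Interior points and essential convexity *)

Lemma rel_interiorP (R : realType) (d : nat) (L A : set 'rV[R]_d) x : L x ->
  rel_interior L A x <-> exists2 e : R, 0 < e &
    forall y, L y -> (forall i, `|x 0 i - y 0 i| < e) -> A y.
Proof.
move=> Lx; rewrite /rel_interior /interior -[nbhs _ _]/(nbhs_subspace (A := L) x A).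
rewrite -nbhs_subspace_in//; split=> [/nbhs_ballP[e /= e0 H]|[e e0 H]].
  exists e => // y Ly xy; apply: H => //; split=> // i j.
  by rewrite (ord1 i); exact: xy.
apply/nbhs_ballP; exists e => //= y [_ xy] Ly; apply: H => // i.
exact: xy.
Qed.

Section EssentiallyConvex.
Context {R : realType} {d : nat}.
Implicit Types (E : set 'rV[R]_d) (a u v x y z : 'rV[R]_d).

Lemma midpoint_nseq E k j x y : midpoint_convex E -> E x -> E y -> (j <= 2 ^ k)%N ->
  E ((j%:R / 2 ^+ k) *: x + (1 - j%:R / 2 ^+ k) *: y).
Proof.
move=> Emid Ex Ey jk.
have -> : (j%:R / 2 ^+ k) *: x + (1 - j%:R / 2 ^+ k) *: y =
    2 ^- k *: \sum_(z <- nseq j x ++ nseq (2 ^ k - j) y) z.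
  have sum_nseq n z : \sum_(w <- nseq n z) w = n%:R *: z.
    elim: n => [|n IHn]; rewrite ?big_nil ?scale0r// big_cons IHn.
    by rewrite -natr1 scalerDl scale1r addrC.
  rewrite big_cat/= !sum_nseq scalerDr !scalerA mulrC; congr (_ + _ *: _).
  by rewrite natrB// natrX mulrBr mulVf ?expf_neq0// mulrC.
apply: midpoint_seq => // [|z].
  by rewrite size_cat !size_nseq subnKC.
by rewrite mem_cat !mem_nseq => /orP[] /andP[_ /eqP->].
Qed.

(** The weights of convex combinations are limits of dyadic weights. *)
Lemma convex_hull_approx E z (e : R) : midpoint_convex E -> convex_hull E z -> 0 < e ->
  exists2 y, E y & forall i, `|z 0 i - y 0 i| < e.
Proof.
move=> Emid hz; pose K := [set z : 'rV[R]_d | forall e : R, 0 < e ->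
  exists2 y, E y & forall i, `|z 0 i - y 0 i| < e].
move: e; suff : K z by [].
apply: hz; split=> [x y lambda|x Ex e e0]; last by exists x => // i; rewrite subrr normr0.
rewrite !inE => Kx Ky e e0.
set t : R := lambda%:num.
have t01 : 0 <= t <= 1 by rewrite /t; apply/andP; split; [exact: ge0|exact: le1].
have -> : conv lambda (x : convex_lmodType 'rV[R]_d) y = t *: x + (1 - t) *: y.
  by [].
have e2 : 0 < e / 2 by rewrite divr_gt0.
have [x' Ex' xx'] := Kx _ e2; have [y' Ey' yy'] := Ky _ e2.
pose M := 1 + enorm (x' - y').
have M0 : 0 < M by rewrite ltr_pwDl// sqrtr_ge0.
have [k hk] : exists k, 2^-1 ^+ k < e / 2 / M.
  by apply: exists_exp_lt; rewrite ?divr_gt0//; apply/andP; split; lra.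
have tk0 : 0 <= 2 ^+ k * t by rewrite mulr_ge0 ?exprn_ge0//; case/andP: t01.
pose j := Num.trunc (2 ^+ k * t).
have /andP[j1 j2] : j%:R <= 2 ^+ k * t < j.+1%:R by exact: truncn_itv.
have jk : (j <= 2 ^ k)%N.
  rewrite -(ler_nat R) natrX (le_trans j1)// ler_piMr ?exprn_ge0//.
  by case/andP: t01.
exists ((j%:R / 2 ^+ k) *: x' + (1 - j%:R / 2 ^+ k) *: y'); first exact: midpoint_nseq.
move=> i; rewrite !mxE; set w := j%:R / 2 ^+ k.
have wt : `|t - w| < e / 2 / M.
  have w1 : w <= t by rewrite /w ler_pdivrMr ?exprn_gt0// mulrC.
  rewrite ger0_norm ?subr_ge0//; apply: le_lt_trans hk.
  rewrite lerBlDr exprVn /w -[X in X + _]mul1r -mulrDl ler_pdivlMr ?exprn_gt0// mulrC ltW//.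
  by rewrite [X in _ < X]addrC natr1.
have xyM : `|x' 0 i - y' 0 i| <= M.
  by have := enorm_coord (x' - y') i; rewrite !mxE /M => /le_trans; apply; rewrite lerDr.
have -> : t * x 0 i + (1 - t) * y 0 i - (w * x' 0 i + (1 - w) * y' 0 i) =
  t * (x 0 i - x' 0 i) + (1 - t) * (y 0 i - y' 0 i) + (t - w) * (x' 0 i - y' 0 i) by ring.
apply: (le_lt_trans (ler_normD _ _)).
have h1 : `|(t - w) * (x' 0 i - y' 0 i)| < e / 2.
  rewrite normrM; apply: (@le_lt_trans _ _ (`|t - w| * M)); first exact: ler_wpM2l.
  by rewrite -ltr_pdivlMr.
have h2 : `|t * (x 0 i - x' 0 i) + (1 - t) * (y 0 i - y' 0 i)| <= e / 2.
  apply: (le_trans (ler_normD _ _)); rewrite !normrM.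
  have := xx' i; have := yy' i; case/andP: t01 => t0 t1.
  rewrite (ger0_norm t0) [`|1 - t|]ger0_norm ?subr_ge0//; nra.
lra.
Qed.

(** A point [z] in the interior of the hull is a combination, with dyadic weights,
    of an interior point [u0] of [E] and of another point [w] of the hull.  If [w]
    is replaced by a nearby point [y] of [E], then [z] remains the same combination
    of [y] and of a point [u] close to [u0]; both are in [E], hence so is [z]. *)
Lemma hull_sub_boundary E (a : 'rV[R]_d) (V : {vspace 'rV[R]_d}) :
  let L := translate a V in midpoint_convex E -> E `<=` L ->
  rel_interior L E !=set0 -> convex_hull E `\` E `<=` rel_boundary L (convex_hull E).
Proof.
move=> L Emid EL [u0 u0E] z [hz nEz]; split; first exact: subset_closure.
have L_aff x y t (c : R) : L x -> L y -> L t -> L (t + c *: (x - y)).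
  move=> [v Vv <-] [w Vw <-] [v' Vv' <-]; exists (v' + c *: (v - w)).
    by rewrite /= rpredD// rpredZ// rpredB.
  by rewrite opprD addrACA subrr add0r addrA.
have hL : convex_hull E `<=` L.
  apply: smallest_sub => // x y lambda; rewrite !inE => Lx Ly.
  have -> : conv lambda (x : convex_lmodType 'rV[R]_d) y =
      x + (lambda%:num - 1) *: (x - y).
    rewrite -[LHS]/(lambda%:num *: x + (1 - lambda%:num) *: y).
    by apply/rowP => i; rewrite !mxE; ring.
  exact: L_aff.
have Lz : L z := hL _ hz.
have Eu0 : E u0 := nbhs_singleton u0E.
have Lu0 : L u0 by exact: EL.
move=> /rel_interiorP -/(_ Lz)[rho rho0 zrho].
have [r r0 u0r] := (rel_interiorP E Lu0).1 u0E.
apply: nEz.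
pose M := 1 + enorm (z - u0); have M0 : 0 < M by rewrite ltr_pwDl// sqrtr_ge0.
have [k hk] : exists k, 2^-1 ^+ k < rho / (2 * M).
  apply: exists_exp_lt; rewrite ?divr_gt0 ?mulr_gt0//; apply/andP; split; lra.
pose h : R := 2 ^+ k.+1 - 1.
have pk0 : 0 < 2 ^+ k :> R by exact: exprn_gt0.
have pk1 : 1 <= 2 ^+ k :> R by rewrite exprn_ege1// ler1n.
have hk1 : 2 ^+ k <= h by rewrite /h exprS; lra.
have h0 : 0 < h by exact: lt_le_trans hk1.
pose w := z + h^-1 *: (z - u0).
have Lw : L w by exact: L_aff.
have hw : convex_hull E w.
  apply: zrho => // i; rewrite !mxE opprD addrA subrr add0r normrN normrM.
  rewrite ger0_norm ?invr_ge0 ?ltW// mulrC ltr_pdivrMr//.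
  have zM : `|z 0 i - u0 0 i| < M.
    by have := enorm_coord (z - u0) i; rewrite !mxE /M => h1; lra.
  move: hk; rewrite exprVn ltr_pdivlMr ?mulr_gt0// mulrC ltr_pdivrMr// => hk.
  have : rho * 2 ^+ k <= rho * h by rewrite ler_pM2l.
  lra.
have [y Ey wy] := convex_hull_approx Emid hw (divr_gt0 r0 h0).
pose u := u0 + h *: (w - y).
have Eu : E u.
  apply: u0r => [|i]; first by apply: L_aff => //; exact: EL.
  rewrite !mxE opprD addrA subrr add0r normrN normrM.
  rewrite gtr0_norm// mulrC -ltr_pdivlMr//.
  by have := wy i; rewrite !mxE.
have -> : z = (1%:R / 2 ^+ k.+1) *: u + (1 - 1%:R / 2 ^+ k.+1) *: y.
  have -> : 2 ^+ k.+1 = h + 1 by rewrite /h subrK.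
  clearbody h.
  apply/rowP => i; rewrite !mxE; field.
  by rewrite !gt_eqF// addr_gt0.
by apply: (@midpoint_nseq E k.+1 1%N) => //; rewrite expn_gt0.
Qed.

Lemma essentially_convex_of_ball E m (a : 'rV[R]_d) (P : 'M[R]_(m, d)) :
  (0 < m)%N -> row_free P -> midpoint_convex E ->
  (forall y, E y -> exists u : 'rV[R]_m, y = a + u *m P) ->
  (exists (z0 : 'rV[R]_m) (r : R), 0 < r /\
     forall z : 'rV[R]_m, (forall i, `|z 0 i - z0 0 i| <= r) -> E (a + z *m P)) ->
  essentially_convex E.
Proof.
move=> m0 Pfree Emid EL [z0 [r [r0 z0r]]].
pose f : 'Hom('rV[R]_m, 'rV[R]_d) := linfun (mulmxr P).
have fE (u : 'rV[R]_m) : f u = u *m P by rewrite lfunE.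
pose V := limg f; pose L := translate a V.
have LP (u : 'rV[R]_m) : L (a + u *m P).
  exists (u *m P) => //=; apply/memv_imgP; exists u; first exact: memvf.
  by rewrite fE.
have dimV : \dim V = m.
  rewrite limg_dim_eq; first by rewrite dimvf dim_matrix; exact: mul1n.
  apply/eqP; rewrite capfv; apply/lker0P => u v; rewrite !fE.
  exact: row_free_inj.
have EsubL : E `<=` L by move=> y /EL[u ->]; exact: LP.
have inner : rel_interior L E !=set0.
  have [Q PQ] := row_freeP Pfree.
  exists (a + z0 *m P); apply/rel_interiorP => //.
  have [K K0 QK] := exists_mulmx_bound Q.
  exists (r / K) => [|y [_ /memv_imgP[u _ ->] <-]]; first by rewrite divr_gt0.
  rewrite fE => yr; apply: z0r => i.
  have -> : u 0 i - z0 0 i = ((u - z0) *m P *m Q) 0 i by rewrite -mulmxA PQ mulmx1 !mxE.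
  have ur j : `|((u - z0) *m P) 0 j| <= r / K.
    by have := yr j; rewrite mulmxBl !mxE opprD addrACA subrr add0r distrC => /ltW.
  have rK : 0 <= r / K by rewrite divr_ge0// ltW.
  by apply: (le_trans (QK _ _ rK ur i)); rewrite divfK ?gt_eqF.
exists m, a, V; split=> //; last exact: hull_sub_boundary.
rewrite m0 /=; have /eqP <- := Pfree; exact: rank_leq_col.
Qed.

(** A maximal family of affinely independent points of [E] affinely spans [E]. *)
Lemma affine_frame E p0 : E p0 -> exists m (P : 'M[R]_(m, d)),
  [/\ row_free P, forall i, E (p0 + row i P) &
      forall y, E y -> exists u : 'rV[R]_m, y = p0 + u *m P].
Proof.
move=> Ep0.
pose frame m := exists P : 'M[R]_(m, d), row_free P /\ forall i, E (p0 + row i P).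
have ex : exists m, `[< frame m >].
  exists 0%N; apply/asboolP; exists 0; split; last by case.
  by rewrite /row_free mxrank0.
have bnd m : `[< frame m >] -> (m <= d)%N.
  by move=> /asboolP[P [/eqP Pfree _]]; rewrite -Pfree rank_leq_col.
case: (ex_maxnP ex bnd) => m /asboolP[P [Pfree EP]] mmax.
exists m, P; split=> // y Ey.
have [/submxP[u yu]|yP] := boolP (y - p0 <= P)%MS.
  by exists u; rewrite -yu addrC subrK.
suff /mmax : `[< frame (1 + m)%N >] by rewrite ltnn.
apply/asboolP; exists (col_mx (y - p0) P); split=> [|i].
  rewrite /row_free eqn_leq rank_leq_row/=.
  have : (P < col_mx (y - p0) P)%MS.
    rewrite /ltmx -addsmxE addsmxSr/=; apply: contra yP => h.
    by apply: submx_trans h; rewrite -?addsmxE addsmxSl.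
  by move=> /rank_ltmx; move/eqP: Pfree => ->.
have [j ->|j ->] := @split_ordP 1 m i.
  by rewrite rowKu row_id addrC subrK.
by rewrite rowKd.
Qed.

End EssentiallyConvex.

(** * The zero-infinity law *)

Lemma continuous_affine (R : realType) (m d : nat) (a : 'rV[R]_d) (P : 'M[R]_(m, d)) :
  continuous (fun u : 'rV[R]_m => a + u *m P).
Proof.
move=> u B /nbhs_ballP[e /= e0 eB]; apply/nbhs_ballP.
have [K K0 PK] := exists_mulmx_bound P.
have [r r0 re] : exists2 r, 0 < r & r < e.
  by exists (e / 2); rewrite ?divr_gt0// ltr_pdivrMr// ltr_pMr// ltr1n.
exists (r / K) => /=; first by rewrite divr_gt0.
move=> v [_ uv]; apply: eB; split=> // i j; rewrite (ord1 i) /ball/=.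
have -> : (a + u *m P) 0 j - (a + v *m P) 0 j = ((u - v) *m P) 0 j.
  by rewrite mulmxBl !mxE; ring.
have uvK k : `|(u - v) 0 k| <= r / K by have := uv 0 k; rewrite /ball/= !mxE => /ltW.
have rK : 0 <= r / K by rewrite divr_ge0// ltW.
by apply: (le_lt_trans (PK _ _ rK uvK j)); rewrite divfK ?gt_eqF.
Qed.

Lemma pow2_half_pow (R : realType) (s : R) m : 2 ^+ m * half_pow s = 2 `^ (m%:R - s).
Proof.
rewrite powRD; last by rewrite pnatr_eq0 implybT.
rewrite powR_mulrn// /half_pow; congr (_ * _).
by rewrite -powR_inv1// -powRrM mulN1r.
Qed.

Lemma powR2_gt1 (R : realType) (t : R) : 0 < t -> 1 < 2 `^ t.
Proof.
move=> t0; have {1}-> : 1 = 1 `^ t :> R by rewrite powR1.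
by rewrite gt0_ltr_powR ?nnegrE// ltr1n.
Qed.

(** Affine coordinates turn [E] into the set [F], in the space of dimension [m] of
    the affine hull of [E].  If [F] is not null then [s <= m]; if [s < m] its
    content is unbounded, and if [s = m] it has interior points, which makes [E]
    essentially convex. *)
Lemma hausdorff_zero_or_infinite (R : realType) (d : nat) (s : R) (E : set 'rV[R]_d) :
  0 < s -> borel_set E -> midpoint_convex E -> ~ essentially_convex E ->
  hausdorff_measure s E = 0%E \/ hausdorff_measure s E = +oo%E.
Proof.
move=> s0 bE Emid nE; have q0 := half_pow_gt0 s.
have [->|/set0P[p0 Ep0]] := eqVneq E set0.
  left; apply: (@hausdorff_null_of_net R 0 d s s0 0 0 set0) => //.
  exact: net_set0.
have [m [P [Pfree EP EL]]] := affine_frame Ep0.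
have [Q PQ] := row_freeP Pfree.
pose F := [set u : 'rV[R]_m | E (p0 + u *m P)].
have [F0|F0] := eqVneq (net (half_pow s) 0 F) 0%E.
  left; apply: (@hausdorff_null_of_net R m d s s0 p0 P F) => // y Ey.
  by have [u yu] := EL _ Ey; exists u => //; rewrite /F/= -yu.
right.
have bF : borel_set F by apply: borel_preimage bE; exact: continuous_affine.
have Fmid : midpoint_convex F.
  move=> u v Fu Fv; rewrite /F/=.
  have -> : p0 + 2^-1 *: (u + v) *m P = 2^-1 *: ((p0 + u *m P) + (p0 + v *m P)).
    rewrite addrACA [RHS]scalerDr -mulmxDl -scalemxAl; congr (_ + _).
    by rewrite -mulr2n -[p0 *+ 2]scaler_nat scalerA mulVf ?scale1r.
  exact: Emid.
have Fz : F 0 by rewrite /F/= mul0mx addr0.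
have Fe i : F (delta_mx 0 i) by rewrite /F/= -rowE; exact: EP.
have := pow2_half_pow s m; have [sm|ms|ms] := ltgtP s m%:R => qE.
- have q1 : 1 < 2 ^+ m * half_pow s by rewrite qE powR2_gt1// subr_gt0.
  have [C C0 HC] := net_le_hausdorff s0 p0 PQ.
  apply: eq_infty => B.
  have [k hk] := net_unbounded q0 Fmid Fz Fe q1 F0 (C * B).
  rewrite -(lee_pmul2l (x := C%:E))// -EFinM; apply: (le_trans hk).
  exact: HC.
- have : net (half_pow s) 0 [set: 'rV[R]_m] = 0%E.
    apply: net_null_of_lt1 => //; rewrite qE -(opprB s) powRN invf_lt1 ?powR_gt0//.
    by rewrite powR2_gt1// subr_gt0.
  move=> N0; case/eqP: F0; apply/le_anti; rewrite net_ge0// andbT -N0.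
  exact: le_net.
- exfalso; apply: nE; apply: (@essentially_convex_of_ball R d E m p0 P) => //.
    by rewrite lt0n -(pnatr_eq0 R) -ms gt_eqF.
  apply: (critical_interior q0) => //.
  by rewrite qE ms subrr powRr0.
Qed.

(** * Lower bounds for sets with prescribed free binary digits *)

(** [u n] lists the first [n] binary digits of [x].  The zero digits, occurring
    infinitely often, make [x] smaller than the right end of each of the nested
    half-open dyadic intervals. *)
Lemma binary_expansion (R : realType) (u : nat -> int) :
  (forall n, u n.+1 = 2 * u n \/ u n.+1 = 2 * u n + 1) ->
  (forall n, exists2 k, (n <= k)%N & u k.+1 = 2 * u k) ->
  exists x : R, forall n, Num.floor (2 ^+ n * x) = u n.
Proof.
move=> ustep uzero.
pose s n : R := (u n)%:~R / 2 ^+ n; pose t n : R := (u n + 1)%:~R / 2 ^+ n.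
have p0 n : 0 < 2 ^+ n :> R by exact: exprn_gt0.
have s_step n : s n <= s n.+1.
  rewrite /s exprS ler_pdivlMr ?mulr_gt0//.
  have -> : (u n)%:~R / 2 ^+ n * (2 * 2 ^+ n) = 2 * (u n)%:~R :> R.
    by rewrite [2 * 2 ^+ n]mulrC mulrA divfK ?gt_eqF// mulrC.
  by have [->|->] := ustep n; rewrite ?intrD intrM; lra.
have t_step n : t n.+1 <= t n.
  rewrite /t exprS ler_pdivrMr ?mulr_gt0//.
  have -> : (u n + 1)%:~R / 2 ^+ n * (2 * 2 ^+ n) = 2 * (u n + 1)%:~R :> R.
    by rewrite [2 * 2 ^+ n]mulrC mulrA divfK ?gt_eqF// mulrC.
  by have [->|->] := ustep n; rewrite !intrD ?intrM; lra.
have s_mono n k : (n <= k)%N -> s n <= s k.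
  by move=> /subnK <-; elim: (k - n)%N => //= j IHj; apply: le_trans IHj _; exact: s_step.
have t_mono n k : (n <= k)%N -> t k <= t n.
  by move=> /subnK <-; elim: (k - n)%N => //= j IHj; apply: le_trans IHj; exact: t_step.
have st n k : s n <= t k.
  apply: (le_trans (s_mono n (maxn n k) (leq_maxl _ _))).
  apply: le_trans (t_mono k (maxn n k) (leq_maxr _ _)).
  by rewrite /s /t ler_pM2r ?invr_gt0// intrD lerDl.
have sup_s : has_sup (range s).
  by split; [exists (s 0%N); exists 0%N|exists (t 0%N) => _ [n _ <-]].
exists (sup (range s)) => n; apply: floor_def; apply/andP; split.
  rewrite mulrC -ler_pdivrMr//; apply: sup_upper_bound => //; by exists n.
have [k nk uk] := uzero n.
rewrite mulrC -ltr_pdivlMr//; apply: (@lt_le_trans _ _ (t k)); last exact: t_mono.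
apply: (@le_lt_trans _ _ (t k.+1)).
  by apply: ge_sup => [|_ [j _ <-]]; [exists (s 0%N); exists 0%N|exact: st].
rewrite /t uk exprS ltr_pdivrMr ?mulr_gt0//.
have -> : (u k + 1)%:~R / 2 ^+ k * (2 * 2 ^+ k) = 2 * (u k + 1)%:~R :> R.
  by rewrite [2 * 2 ^+ k]mulrC mulrA divfK ?gt_eqF// mulrC.
by rewrite !intrD intrM; lra.
Qed.

Lemma sum_esum_disjoint (R : realType) (T : finType) (U : choiceType)
    (B : T -> set U) (D : set U) (a : U -> \bar R) : (forall c, 0 <= a c)%E ->
  (forall b, B b `<=` D) -> (forall b b' c, B b c -> B b' c -> b = b') ->
  (\sum_b \esum_(c in B b) a c <= \esum_(c in D) a c)%E.
Proof.
move=> a0 BD Bdisj.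
have -> : (\sum_b \esum_(c in B b) a c =
    \sum_b \esum_(c in D) (if c \in B b then a c else 0))%E.
  apply: eq_bigr => b _; rewrite -esum_mkcondr; congr esum.
  by apply/esym/setIidPr; exact: BD.
rewrite -esum_sum => [|c b _ _]; last by case: ifP.
apply: le_esum => c _; have [[b Bb]|nB] := pselect (exists b, B b c).
  rewrite (bigD1 b)//= mem_set// big1 ?adde0// => b' bb'.
  case: ifP => //; rewrite inE => /(Bdisj _ _ _ Bb) bE.
  by rewrite bE eqxx in bb'.
rewrite big1// => b _; case: ifP => //; rewrite inE => Bb.
by exfalso; apply: nB; exists b.
Qed.

Section FreeDigits.
Context {R : realType} {d : nat} (q : R) (free : pred nat).
Hypothesis q0 : 0 < q.

(** The digit at place [n.+1] is zero unless [free n]. *)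
Definition digit_set : set 'rV[R]_d :=
  [set x | forall n, ~~ free n -> cell_of n.+1 x = 2 *: cell_of n x].

Definition free_count n := (\sum_(j < n) free j)%N.

(** Suppose the cells of [S] have total cost less than [c].  Starting from the
    unit cell, one descends to a subcell allowed by the digit rule in such a way
    that the cost of the cells of [S] below the current cell stays less than
    [c] times the share [(2 ^ d) ^- free_count n] of that cell.  Such a cell cannot
    itself belong to [S], so the limit of the descent is not covered. *)
Lemma net_digit_set (c : R) : 0 < c ->
  (forall n, c <= q ^+ n * (2 ^+ d) ^+ free_count n) ->
  (forall n, exists2 k, (n <= k)%N & ~~ free k) ->
  (c%:E <= net q 0 digit_set)%E.
Proof.
move=> c0 cq nfree; apply: net_ge => S KS _; rewrite leNgt; apply/negP => Sc.
pose w (c : @cell d) : \bar R := (q ^+ c.1)%:E.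
have w0 c' : (0 <= w c')%E by rewrite lee_fin exprn_ge0// ltW.
pose below n (l : 'rV[int]_d) : set (@cell d) :=
  [set c' | [/\ S c', (n <= c'.1)%N & exists2 x : 'rV[R]_d, cube c' x & cell_of n x = l]].
pose W n l := (\esum_(c' in below n l) w c')%E.
pose light n l := (W n l * ((2 ^+ d) ^+ free_count n)%:E < c%:E)%E.
pose child (l : 'rV[int]_d) (b : {ffun 'I_d -> 'I_2}) := 2 *: l + \row_i (b i)%:Z.
have cell_child n (x : 'rV[R]_d) : exists b, cell_of n.+1 x = child (cell_of n x) b.
  have [b _] := @cube_subdivide R d 1 (n, cell_of n x) x (cube_cell_of n x).
  by rewrite /cube/= addn1 expr1 => xb; exists b.
have child_inj l l' b b' : child l b = child l' b' -> l = l' /\ b = b'.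
  move=> /rowP h.
  have lb i : l 0 i = l' 0 i /\ b i = b' i :> nat.
    have : 2 * l 0%R i + (b i)%:Z = 2 * l' 0%R i + (b' i)%:Z :> int.
      by have := h i; rewrite !mxE.
    by have := ltn_ord (b i); have := ltn_ord (b' i); lia.
  by split; [apply/rowP|apply/ffunP] => i; have [? ?] := lb i; last apply/val_inj.
have below_child n l b : below n.+1 (child l b) `<=` below n l.
  move=> c' [Sc' nc' [x cx xl]]; split=> //; first exact: ltnW.
  exists x => //; have [b' xb'] := cell_child n x.
  by have [] : cell_of n x = l /\ b' = b by apply: child_inj; rewrite -xb' xl.
have step n l : exists l', light n l -> light n.+1 l' /\
    exists b, l' = child l b /\ (~~ free n -> forall i, b i = ord0).
  have [nl|nl] := pselect (light n l); last by exists l.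
  have fE : free_count n.+1 = (free_count n + free n)%N by rewrite /free_count big_ord_recr.
  have M0 : 0 < (2 ^+ d) ^+ free_count n :> R by rewrite !exprn_gt0.
  have d0 : 0 < 2 ^+ d :> R by rewrite exprn_gt0.
  have [fn|fn] := boolP (free n); last first.
    exists (child l [ffun=> ord0]) => _; split; last first.
      by exists [ffun=> ord0]; split=> // _ i; rewrite ffunE.
    rewrite /light fE (negPf fn) addn0; apply: le_lt_trans nl.
    by rewrite lee_pmul2r//; apply: le_esum_subset.
  have [[b lb]|nb] := pselect (exists b, light n.+1 (child l b)).
    by exists (child l b) => _; split=> //; exists b.
  exfalso; move: nl; rewrite /light ltNge => /negP; apply.
  rewrite -lee_pdivrMr//.
  apply: (@le_trans _ _ (\sum_(b : {ffun 'I_d -> 'I_2}) W n.+1 (child l b))%E); last first.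
    apply: sum_esum_disjoint => // b b' c' [_ nc' [x cx xb]] [_ _ [y cy yb]].
    have : child l b = child l b' by rewrite -xb -yb; apply: (cell_of_le nc'); rewrite cx cy.
    by move=> /child_inj[].
  apply: (@le_trans _ _ (\sum_(b : {ffun 'I_d -> 'I_2})
      (c / ((2 ^+ d) ^+ free_count n * 2 ^+ d))%:E)%E); last first.
    apply: lee_sum => b _; rewrite EFinM lee_pdivrMr ?mulr_gt0// leNgt.
    apply/negP => lb; apply: nb; exists b.
    by rewrite /light fE fn exprD expr1.
  rewrite sumEFin sumr_const card_ffun !card_ord -EFinM lee_fin -[leRHS]mulr_natr natrX.
  by rewrite invfM mulrA divfK// gt_eqF.
have /choice[g gP] : forall nl : nat * 'rV[int]_d, exists l', light nl.1 nl.2 ->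
    light nl.1.+1 l' /\ exists b, l' = child nl.2 b /\ (~~ free nl.1 -> forall i, b i = ord0).
  by move=> [n l]; exact: step.
pose fix l_ n : 'rV[int]_d := if n is n'.+1 then g (n', l_ n') else 0.
have l_light n : light n (l_ n).
  elim: n => [|n /(gP (n, l_ n))[]//].
  rewrite /light /free_count big_ord0 expr0 mule1; apply: le_lt_trans Sc.
  by apply: le_esum_subset => // c' [].
have l_step n := (gP (n, l_ n) (l_light n)).2; rewrite /= in l_step.
have /choice[x xP] : forall i, exists xi : R, forall n, Num.floor (2 ^+ n * xi) = l_ n 0 i.
  move=> i; apply: binary_expansion => n.
    have [b [/= -> _]] := l_step n; rewrite !mxE.
    by case: (b i) => -[|[|//]] ? /=; [left; rewrite addr0|right].
  have [k nk fk] := nfree n; exists k => //.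
  by have [b [/= -> /(_ fk) b0]] := l_step k; rewrite !mxE b0 addr0.
pose y : 'rV[R]_d := \row_i x i.
have yl n : cell_of n y = l_ n by apply/rowP => i; rewrite !mxE xP.
have Ky : digit_set y.
  move=> n fn; rewrite !yl; have [b [/= -> /(_ fn) b0]] := l_step n.
  by apply/rowP => i; rewrite !mxE b0 addr0.
have [[n l] Snl] := KS _ Ky; rewrite /cube/= yl => ln.
have := l_light n; apply/negP; rewrite -leNgt.
apply: (@le_trans _ _ ((q ^+ n)%:E * ((2 ^+ d) ^+ free_count n)%:E)%E).
  by rewrite -EFinM lee_fin.
rewrite lee_pmul2r// ?lte_fin ?exprn_gt0//.
rewrite -[leLHS]/(w (n, l)) -(esum_set1 (t := (n, l)) (a := w))//.
apply: le_esum_subset => // _ ->; split=> //.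
by exists y; rewrite /cube/= yl.
Qed.

End FreeDigits.

(** * Sets of points close to dyadic points *)

Section NearDyadic.
Context {R : realType} {d : nat}.

(** The binary digits of the coordinates vanish at the places after [a k + C] up
    to [b k].  Halving a sum spoils one more digit at the start of each window, and
    the quantifier on [C] absorbs this loss. *)
Definition near_dyadic (a b : nat -> nat) : set 'rV[R]_d :=
  [set x | exists C : nat, forall k i, exists z : int,
    0 <= x 0 i - z%:~R / 2 ^+ (a k + C) < 2 ^- b k].

Variables a b : nat -> nat.

Lemma near_dyadic_midpoint : midpoint_convex (near_dyadic a b).
Proof.
move=> x y [C Cx] [C' Cy]; exists (C + C').+1 => k i.
have [z /andP[z1 z2]] := Cx k i; have [w /andP[w1 w2]] := Cy k i.
exists (z * 2 ^+ C' + w * 2 ^+ C); rewrite !mxE.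
have -> : 2^-1 * (x 0 i + y 0 i) -
    (z * 2 ^+ C' + w * 2 ^+ C)%:~R / 2 ^+ (a k + (C + C').+1) =
    ((x 0 i - z%:~R / 2 ^+ (a k + C)) + (y 0 i - w%:~R / 2 ^+ (a k + C'))) / 2 :> R.
  rewrite addnS exprS !exprD intrD !intrM !rmorphXn/=.
  by field; rewrite !expf_neq0.
by apply/andP; split; lra.
Qed.

Lemma near_dyadic_borel : borel_set (near_dyadic a b).
Proof.
rewrite (_ : near_dyadic a b = \bigcup_(C in [set: nat]) \bigcap_(k in [set: nat])
    \bigcap_(i in [set: 'I_d]) \bigcup_(z in [set: int])
    ([set x | x 0 i < 2 ^- b k + z%:~R / 2 ^+ (a k + C)] `&`
     ~` [set x | x 0 i < z%:~R / 2 ^+ (a k + C)])).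
  apply: borel_bigcup => C _; apply: borel_bigcap => k _; apply: borel_bigcap => i _.
  apply: borel_bigcup => z _; apply: borel_setI; last apply: borel_setC;
    exact: borel_coord_lt.
apply/seteqP; split=> [x [C Cx]|x [C _ Cx]]; exists C => //.
  move=> k _ i _; have [z /andP[z1 z2]] := Cx k i; exists z => //; split=> /=.
    by rewrite -ltrBlDr.
  by apply/negP; rewrite -leNgt -subr_ge0.
move=> k i; have [z _ [/= z2 /negP]] := Cx k Logic.I i Logic.I.
by rewrite -leNgt -subr_ge0 => z1; exists z; rewrite z1 ltrBlDr.
Qed.

Lemma near_dyadic_int (x : 'rV[int]_d) : near_dyadic a b (map_mx intr x).
Proof.
exists 0%N => k i; exists (x 0 i * 2 ^+ a k); rewrite mxE addn0 intrM rmorphXn/=.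
by rewrite mulfK ?expf_neq0// subrr lexx invr_gt0 exprn_gt0.
Qed.

(** A fraction with denominator [2 ^ i] is at distance at least
    [2 ^- (i + n) / 3] from such a coordinate, since 3 does not divide a power of
    2, while long windows demand better approximations. *)
Lemma near_dyadic_third (j : int) n (x : 'rV[R]_d) i :
  (forall k, (a k + k <= b k)%N) ->
  x 0 i = (3 * j + 1)%:~R / (3 * 2 ^+ n) -> ~ near_dyadic a b x.
Proof.
move=> ab xi [C Cx]; pose k := (C + n).+2.
have [z /andP[z1 z2]] := Cx k i.
pose P := (2 ^ (a k + C))%N; pose Q := (2 ^ n)%N.
pose D : int := (3 * j + 1) * P%:Z - 3 * z * Q%:Z.
have P0 : 0 < 2 ^+ (a k + C) :> R by rewrite exprn_gt0.
have Q0 : 0 < 2 ^+ n :> R by rewrite exprn_gt0.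
have DE : D%:~R = (x 0 i - z%:~R / 2 ^+ (a k + C)) * (3 * 2 ^+ n * 2 ^+ (a k + C)) :> R.
  have PE : P%:Z%:~R = 2 ^+ (a k + C) :> R by rewrite -pmulrn natrX.
  have QE : Q%:Z%:~R = 2 ^+ n :> R by rewrite -pmulrn natrX.
  by rewrite xi /D intrB !intrM PE QE; field; rewrite !gt_eqF.
have bk : 2 ^- b k <= ((2 ^+ (a k + C) * 2 ^+ n) * 4)^-1 :> R.
  rewrite lef_pV2 ?posrE ?exprn_gt0 ?mulr_gt0//.
  have -> : 4 = 2 ^+ 2 :> R by rewrite -natrX.
  rewrite -!exprD ler_eXn2l ?ltr1n//.
  by apply: leq_trans (ab k); rewrite /k; lia.
have D0 : 0 <= D by rewrite -(ler_int R) DE mulr_ge0// ltW// !mulr_gt0.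
have D1 : D < 1.
  rewrite -(ltr_int R) DE -ltr_pdivlMr ?mulr_gt0// mul1r.
  apply: (lt_le_trans z2); apply: (le_trans bk).
  rewrite lef_pV2 ?posrE ?mulr_gt0//.
  have : 0 < 2 ^+ (a k + C) * 2 ^+ n :> R by exact: mulr_gt0.
  have -> : 3 * 2 ^+ n * 2 ^+ (a k + C) = 3 * (2 ^+ (a k + C) * 2 ^+ n) :> R by ring.
  lra.
have DZ : D = 0 by lia.
have : (3 %| P)%N.
  have : (3 %| P%:Z)%Z.
    apply/dvdzP; exists (z * Q%:Z - j * P%:Z); rewrite /D in DZ; lia.
  by [].
by rewrite /P Euclid_dvdX.
Qed.

(** The set contains the integer points, so only the whole space can play the
    role of its affine hull, and there it has empty interior. *)
Lemma near_dyadic_not_essentially_convex : (1 <= d)%N ->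
  (forall k, (a k + k <= b k)%N) -> ~ essentially_convex (near_dyadic a b).
Proof.
move=> d1 ab [m [v [V [_ _ EL [x0 x0E] _]]]]; set L := translate v V in EL x0E.
have [w0 Vw0 vw0] : L 0.
  by apply: EL; have := near_dyadic_int 0; rewrite map_mx0.
have w0E : w0 = - v by apply/eqP; rewrite -addr_eq0 addrC vw0.
have Vfull x : x \in V.
  rewrite [x]row_sum_delta; apply: rpred_sum => i _; apply: rpredZ.
  have [w Vw <-] : L (delta_mx 0 i).
    by apply: EL; have := near_dyadic_int (delta_mx 0 i); rewrite map_delta_mx.
  by rewrite -[v]opprK -w0E addrC rpredB.
have Lfull x : L x by exists (x - v); rewrite /= ?Vfull// addrC subrK.
have [e e0 x0e] := (rel_interiorP (near_dyadic a b) (Lfull x0)).1 x0E.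
pose i0 : 'I_d := Ordinal d1.
have [n ne] : exists n, 2^-1 ^+ n < e.
  by apply: exists_exp_lt => //; apply/andP; split; lra.
pose j := Num.floor (2 ^+ n * x0 0 i0).
pose c : R := (3 * j + 1)%:~R / (3 * 2 ^+ n).
pose y : 'rV[R]_d := \row_i (if i == i0 then c else x0 0 i).
apply: (@near_dyadic_third j n y i0 ab); first by rewrite mxE eqxx.
apply: x0e => // i; rewrite mxE; case: eqP => [->|_]; last by rewrite subrr normr0.
apply: le_lt_trans ne; rewrite exprVn -[leRHS]mul1r ler_pdivlMr ?exprn_gt0//.
rewrite -[X in _ * X]ger0_norm ?exprn_ge0// -normrM mulrC mulrBr.
have -> : 2 ^+ n * c = j%:~R + 1 / 3.
  by rewrite /c intrD intrM; field; rewrite expf_neq0.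
have /andP[j1 j2] := floor_itv (2 ^+ n * x0 0 i0); rewrite -/j in j1 j2.
by move: j2; rewrite intrD => j2; rewrite ler_norml; apply/andP; split; lra.
Qed.

(** For fixed [C], a window places the points of a unit cube in cells of level
    [b k], at most one in each of the [(2 ^ d) ^ (a k + C)] cells of level
    [a k + C]. *)
Lemma near_dyadic_null (q : R) : 0 < q ->
  (forall (C : nat) (M : R), 0 < M -> exists k,
    (a k + C <= b k)%N /\ (2 ^+ d) ^+ a k * q ^+ b k < M) ->
  net q 0 (near_dyadic a b) = 0%E.
Proof.
move=> q0 small.
pose X (Cj : nat * 'rV[int]_d) : set 'rV[R]_d :=
  [set x | cube (0%N, Cj.2) x /\ forall k i, exists z : int,
    0 <= x 0 i - z%:~R / 2 ^+ (a k + Cj.1) < 2 ^- b k].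
rewrite (_ : near_dyadic a b = \bigcup_(Cj in [set: nat * 'rV[int]_d]) X Cj); last first.
  apply/seteqP; split=> [x [C Cx]|x [[C j] _ [_ Cx]]]; last by exists C.
  by exists (C, cell_of 0 x).
apply: net_null_bigcup => // -[C j] _; apply/le_anti; rewrite net_ge0// andbT.
apply/lee_addgt0Pr => e e0; rewrite add0e.
have d0 : 0 < (2 ^+ d) ^+ C :> R by rewrite !exprn_gt0.
have [k [ab kM]] := small C (e / (2 ^+ d) ^+ C) (divr_gt0 e0 d0).
pose A := (a k + C)%N.
pose f (t : {ffun 'I_d -> 'I_(2 ^ A)}) : @cell d :=
  (b k, 2 ^+ (b k - A) *: (2 ^+ A *: j + \row_i (t i)%:Z)).
have Xf : X (C, j) `<=` \bigcup_t cube (f t).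
  move=> x [/= jx Cx]; have [t _ xt] := cube_subdivide A jx.
  exists t => //; move: xt; rewrite /cube/= add0n => xt.
  apply/cell_ofP => i; have [z] := Cx k i; rewrite -/A => zx.
  have pA : 0 < 2 ^+ A :> R by rewrite exprn_gt0.
  have pbA : 0 < 2 ^+ (b k - A) :> R by rewrite exprn_gt0.
  have bE : 2 ^+ b k = 2 ^+ (b k - A) * 2 ^+ A :> R by rewrite -exprD subnK.
  have zE : z = cell_of A x 0 i.
    rewrite mxE; apply/esym/floor_def; move: zx => /andP[z1 z2].
    rewrite -ler_pdivrMl// -ltr_pdivlMl//.
    have : 2 ^- b k <= 2 ^- A :> R by rewrite lef_pV2 ?posrE ?exprn_gt0// ler_eXn2l ?ltr1n.
    rewrite intrD ![_^-1 * _]mulrC mulrDl mul1r => h.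
    by apply/andP; split; lra.
  have fE : (2 ^+ (b k - A) *: (2 ^+ A *: j + \row_i0 (t i0)%:Z)) 0 i = 2 ^+ (b k - A) * z.
    by rewrite zE xt mxE.
  rewrite fE intrD intrM rmorphXn/= bE -mulrA.
  move: zx => /andP[z1 z2].
  have -> : x 0 i = (x 0 i - z%:~R / 2 ^+ A) + z%:~R / 2 ^+ A by rewrite subrK.
  rewrite mulrDr [2 ^+ A * (z%:~R / _)]mulrC divfK ?gt_eqF// mulrDr.
  apply/andP; split; first by rewrite lerDr mulr_ge0 ?mulr_ge0// ltW.
  rewrite addrC ltrD2l mulrA -bE -ltr_pdivlMl ?exprn_gt0//.
  by rewrite mulr1.
apply: (le_trans (net_finType q0 Xf _ (leq0n (b k)))) => //.
rewrite lee_fin card_ffun !card_ord !natrX -exprM mulnC exprM /A exprD mulrAC.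
by rewrite -ler_pdivlMr// ltW.
Qed.

End NearDyadic.

(** * Windows of vanishing digits *)

Section Windows.
Context {R : realType} {d : nat}.
Variables A B : nat -> nat.
Hypotheses (B0 : B 0%N = 0%N) (BA : forall k, (B k <= A k)%N)
  (AB : forall k, (A k < B k.+1)%N).

Definition outside_windows : pred nat :=
  [pred n | `[< forall k, ~~ ((A k <= n) && (n < B k.+1))%N >] ].

Local Notation free := outside_windows.

Let B_mono i j : (i <= j)%N -> (B i <= B j)%N.
Proof.
move=> /subnK <-; elim: (j - i)%N => // n /leq_trans; apply.
exact: leq_trans (BA _) (ltnW (AB _)).
Qed.

Let A_mono i j : (i <= j)%N -> (A i <= A j)%N.
Proof.
rewrite leq_eqVlt => /predU1P[->//|ij].
apply: leq_trans (ltnW (AB i)) _; apply: leq_trans (BA j).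
exact: B_mono.
Qed.

Let in_window k n : (A k <= n)%N -> (n < B k.+1)%N -> ~~ free n.
Proof.
by move=> An nB; apply/asboolP => /(_ k); rewrite An nB.
Qed.

Let between_windows k n : (B k <= n)%N -> (n < A k)%N -> free n.
Proof.
move=> Bn nA; apply/asboolP => i; rewrite negb_and -ltnNge -leqNgt.
have [ik|ki] := ltnP i k.
  by apply/orP; right; apply: leq_trans Bn; exact: B_mono.
by apply/orP; left; apply: leq_trans nA _; exact: A_mono.
Qed.

Lemma digit_set_near_dyadic :
  digit_set free `<=` near_dyadic (R := R) (d := d) A (fun k => B k.+1).
Proof.
move=> x xD; exists 0%N => k i; rewrite addn0.
have digits n : (A k + n <= B k.+1)%N -> cell_of (A k + n) x = 2 ^+ n *: cell_of (A k) x.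
  elim: n => [|n IHn]; first by rewrite addn0 expr0 scale1r.
  rewrite addnS => nB; rewrite xD ?IHn ?scalerA -?exprS//; first exact: ltnW.
  by apply: (@in_window k) => //; exact: leq_addr.
have := digits (B k.+1 - A k)%N; rewrite subnKC ?(ltnW (AB k))// => /(_ (leqnn _)) xE.
exists (cell_of (A k) x 0 i).
have pA : 0 < 2 ^+ A k :> R by rewrite exprn_gt0.
have pB : 0 < 2 ^+ B k.+1 :> R by rewrite exprn_gt0.
have : (cell_of (A k) x 0 i)%:~R <= 2 ^+ A k * x 0 i.
  by have /cell_ofP/(_ i)/andP[] := erefl (cell_of (A k) x).
have : 2 ^+ B k.+1 * x 0 i < (2 ^+ (B k.+1 - A k) * cell_of (A k) x 0 i + 1)%:~R.
  have zE : (2 ^+ (B k.+1 - A k) *: cell_of (A k) x) 0 i =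
      2 ^+ (B k.+1 - A k) * cell_of (A k) x 0 i by rewrite [LHS]mxE.
  by have /cell_ofP/(_ i)/andP[_] := xE; rewrite zE.
move: (cell_of (A k) x 0 i) => z; rewrite intrD intrM rmorphXn/= => x2 x1.
rewrite subr_ge0 ler_pdivrMr// [x 0 i * _]mulrC x1/=.
rewrite -(ltr_pM2l pB) mulrBr mulfV ?gt_eqF//.
have -> : 2 ^+ B k.+1 * (z%:~R / 2 ^+ A k) = 2 ^+ (B k.+1 - A k) * z%:~R :> R.
  rewrite -[in LHS](subnK (ltnW (AB k))) exprD -mulrA; congr (_ * _).
  by rewrite mulrC divfK ?gt_eqF.
lra.
Qed.

Let free_countS n : free_count free n.+1 = (free_count free n + free n)%N.
Proof. by rewrite /free_count big_ord_recr. Qed.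

Let free_count_between k n : (B k <= n)%N -> (n <= A k)%N ->
  free_count free n = (free_count free (B k) + (n - B k))%N.
Proof.
move=> Bn; rewrite -{1 2}(subnKC Bn); elim: (n - B k)%N => [|j IHj]; first by rewrite !addn0.
rewrite addnS => jA; rewrite free_countS IHj ?(ltnW jA)//.
by rewrite (@between_windows k) ?leq_addr// addnS addn1.
Qed.

Let free_count_mono n j : (n <= j)%N -> (free_count free n <= free_count free j)%N.
Proof.
move=> /subnK <-; elim: (j - n)%N => // i /leq_trans; apply.
by rewrite addSn free_countS leq_addr.
Qed.

(** On a window the quantity [t * n - d * free_count n] grows with [n], elsewhere
    it does not, so it is largest at the ends of windows. *)
Lemma free_count_ge (t G : R) : 0 <= t <= d%:R -> 0 <= G ->
  (forall k, t * (B k.+1)%:R - d%:R * (A k - B k)%:R <= G) ->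
  forall n, t * n%:R - d%:R * (free_count free n)%:R <= G.
Proof.
move=> /andP[t0 td] G0 HG.
have d0 : 0 <= d%:R :> R by exact: ler0n.
have window_end k : t * (B k)%:R - d%:R * (free_count free (B k))%:R <= G.
  case: k => [|k]; first by rewrite B0 mulr0 sub0r (le_trans _ G0)// oppr_le0 mulr_ge0.
  apply: le_trans (HG k); rewrite lerD2l lerN2 ler_wpM2l// ler_nat.
  apply: (@leq_trans (free_count free (A k))).
    by rewrite (free_count_between (BA k) (leqnn _)) leq_addl.
  by apply: free_count_mono; exact: ltnW.
move=> n; have [k kn nk] : exists2 k, (B k <= n)%N & (n < B k.+1)%N.
  have ex : exists k, (B k <= n)%N by exists 0%N; rewrite B0.
  have bnd k : (B k <= n)%N -> (k <= n)%N.
    apply: leq_trans; elim: k => // k IHk; apply: leq_ltn_trans IHk _.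
    exact: leq_ltn_trans (BA k) (AB k).
  case: (ex_maxnP ex bnd) => k Bk kmax; exists k => //.
  by rewrite ltnNge; apply/negP => /kmax; rewrite ltnn.
have [nA|An] := leqP n (A k).
  rewrite (free_count_between kn nA) natrD natrB//.
  have := window_end k; have : 0 <= (d%:R - t) * (n%:R - (B k)%:R).
    by rewrite mulr_ge0 ?subr_ge0// ler_nat.
  nra.
have : t * n%:R <= t * (B k.+1)%:R by rewrite ler_wpM2l// ler_nat ltnW.
have : d%:R * (A k - B k)%:R <= d%:R * (free_count free n)%:R :> R.
  rewrite ler_wpM2l// ler_nat; apply: leq_trans (free_count_mono (ltnW An)).
  by rewrite (free_count_between (BA k) (leqnn _)) leq_addl.
have := HG k; lra.
Qed.

End Windows.

Lemma pow_balance (R : realType) (d i n : nat) (t : R) :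
  half_pow t ^+ n * (2 ^+ d) ^+ i = 2 `^ (d%:R * i%:R - t * n%:R).
Proof.
rewrite powRD; last by rewrite pnatr_eq0 implybT.
rewrite powRrM !powR_mulrn ?exprn_ge0// mulrC; congr (_ * _).
rewrite powRN powRrM powR_mulrn ?powR_ge0// -exprVn; congr (_ ^+ _).
by rewrite /half_pow -powR_inv1// -powRrM mulN1r powRN.
Qed.

Lemma near_dyadic_pos (R : realType) (d : nat) (A B : nat -> nat) (t : R) :
  B 0%N = 0%N -> (forall k, (B k <= A k)%N) -> (forall k, (A k < B k.+1)%N) ->
  0 <= t <= d%:R ->
  (exists G, forall k, t * (B k.+1)%:R - d%:R * (A k - B k)%:R <= G) ->
  net (half_pow t) 0 (near_dyadic A (fun k => B k.+1) : set 'rV[R]_d) != 0%E.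
Proof.
move=> B0 BA AB td [G HG]; pose G' := Num.max G 0.
have G'0 : 0 <= G' by rewrite le_max lexx orbT.
have HG' k : t * (B k.+1)%:R - d%:R * (A k - B k)%:R <= G'.
  by rewrite (le_trans (HG k))// le_max lexx.
have bound := free_count_ge B0 BA AB td G'0 HG'.
have c0 : 0 < 2 `^ (- G') :> R by rewrite powR_gt0.
rewrite gt_eqF//; apply: (@lt_le_trans _ _ (2 `^ (- G'))%:E); first by rewrite lte_fin.
apply: (@le_trans _ _ (net (half_pow t) 0
    (digit_set (outside_windows A B) : set 'rV[R]_d))); last first.
  by apply: le_net; exact: digit_set_near_dyadic.
apply: net_digit_set => //; first exact: half_pow_gt0.
  by move=> n; rewrite pow_balance ler_powR ?ler1n//; have := bound n; lra.
move=> n; exists (A n).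
  elim: n => // n IHn; apply: leq_trans (BA _); exact: leq_ltn_trans IHn (AB n).
by apply/asboolP => /(_ n); rewrite leqnn AB.
Qed.

Lemma near_dyadic_null_exp (R : realType) (d : nat) (a b : nat -> nat) (t : R) :
  (forall k, (a k + k <= b k)%N) ->
  (forall N, exists2 k, (N <= k)%N & N%:R <= t * (b k)%:R - d%:R * (a k)%:R) ->
  net (half_pow t) 0 (near_dyadic a b : set 'rV[R]_d) = 0%E.
Proof.
move=> ab abt; apply: near_dyadic_null => [|C M M0]; first exact: half_pow_gt0.
have [n hn] : exists n, 2^-1 ^+ n < M.
  by apply: exists_exp_lt => //; apply/andP; split; lra.
have [k Nk hk] := abt (maxn C n); exists k; split.
  apply: leq_trans (ab k); rewrite leq_add2l; exact: leq_trans (leq_maxl _ _) Nk.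
rewrite mulrC pow_balance; apply: le_lt_trans hn.
rewrite exprVn -powR_invn// ler_powR ?ler1n//.
have : n%:R <= (maxn C n)%:R :> R by rewrite ler_nat leq_maxr.
lra.
Qed.

Lemma exists_nat_ge (R : realType) (N : nat) (c M : R) : 0 < c ->
  exists2 k, (N <= k)%N & M <= c * k.+1%:R.
Proof.
move=> c0; exists (maxn N (Num.bound `|M / c|)); first exact: leq_maxl.
rewrite mulrC -ler_pdivrMr//; apply: (le_trans (ler_norm _)); apply: ltW.
have h : `|M / c| < (Num.bound `|M / c|)%:R by exact: archi_boundP.
apply: (lt_le_trans h); rewrite ler_nat; apply: leqW; exact: leq_maxr.
Qed.

(** The factor [k.+1] in the lower bound for [A k] makes everything that precedes a
    window negligible.  The end of the window is determined by the dimension [s],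
    up to the correction [g] to be chosen. *)
Lemma window_sequences (R : realType) (d K : nat) (s : R) (g : nat -> nat -> R) :
  0 < s -> (0 < K)%N ->
  (forall k b, let a := (K * (k.+1 * (b + k.+1)))%N in
     s * (a + k.+1)%:R <= d%:R * a%:R + g k b) ->
  exists A B : nat -> nat,
  [/\ B 0%N = 0%N, forall k, (k.+1 * (B k + k.+1) <= A k)%N,
      forall k, (A k + k.+1 <= B k.+1)%N &
      forall k, d%:R * (A k)%:R + g k (B k) - s < s * (B k.+1)%:R
                <= d%:R * (A k)%:R + g k (B k)].
Proof.
move=> s0 K0 Hg.
pose a k b := (K * (k.+1 * (b + k.+1)))%N.
pose fix B k : nat := if k is k'.+1 then
  Num.trunc ((d%:R * (a k' (B k'))%:R + g k' (B k')) / s) else 0%N.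
exists (fun k => a k (B k)), B; split=> // k.
- by rewrite /a leq_pmull.
- rewrite /= truncn_ge_nat; last first.
    by rewrite divr_ge0 ?(ltW s0)// (le_trans _ (Hg k (B k)))// mulr_ge0 ?(ltW s0).
  by rewrite ler_pdivlMr// mulrC; exact: Hg.
- rewrite /=; set Y := _ + g k (B k); have Y0 : 0 <= Y.
    by rewrite (le_trans _ (Hg k (B k)))// mulr_ge0 ?(ltW s0).
  have /andP[] := truncn_itv (divr_ge0 Y0 (ltW s0)).
  move: (Num.trunc (Y / s)) => n; rewrite ler_pdivlMr// ltr_pdivrMr// -natr1.
  by move=> h1 h2; apply/andP; split; lra.
Qed.

(** With [g k b = s * k.+2] the cover at the end of the window [k] has total cost of
    order [2 ^ (- s * k)], which tends to 0, at the exponent [s] itself; for an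
    exponent below [s] the main term [d * A k] prevails over the correction. *)
Lemma window_sequences_null (R : realType) (d : nat) (s : R) :
  (1 <= d)%N -> 0 < s -> s <= d%:R -> exists A B : nat -> nat,
  [/\ B 0%N = 0%N, forall k, (B k <= A k)%N, forall k, (A k + k.+1 <= B k.+1)%N,
      forall t, s <= t -> forall N, exists2 k, (N <= k)%N &
        N%:R <= t * (B k.+1)%:R - d%:R * (A k)%:R &
      forall t, 0 <= t < s -> exists G, forall k,
        t * (B k.+1)%:R - d%:R * (A k - B k)%:R <= G].
Proof.
move=> d1 s0 sd; have dR1 : 1 <= d%:R :> R by rewrite ler1n.
have [|A [B [B0 kA AB sB]]] := @window_sequences R d 1 s (fun k _ => s * (k.+2)%:R) s0 isT.
  move=> k b; move: (1 * _)%N => a /=.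
  rewrite natrD -[k.+2%:R]natr1; have : 0 <= (d%:R - s) * a%:R by rewrite mulr_ge0 ?subr_ge0.
  rewrite !mulrDr mulr1 mulrBl => h; have := s0; lra.
have BA k : (B k <= A k)%N.
  by apply: leq_trans (kA k); rewrite -[leqLHS]mul1n leq_mul// leq_addr.
exists A, B; split=> //.
  move=> t st N; have [k Nk hk] := exists_nat_ge N N%:R s0; exists k => //.
  have /andP[h1 _] := sB k; rewrite -natr1 mulrDr mulr1 in h1.
  have : s * (B k.+1)%:R <= t * (B k.+1)%:R by rewrite ler_wpM2r.
  lra.
move=> t /andP[t0 ts].
have st : 0 < s - t by rewrite subr_gt0.
have [k0 _ hk0] := exists_nat_ge 0 (2 * s) st.
have B_mono i j : (i <= j)%N -> (B i <= B j)%N.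
  move=> /subnK <-; elim: (j - i)%N => // n /leq_trans; apply.
  apply: leq_trans (BA _) _; apply: leq_trans (AB _); exact: leq_addr.
exists (t * (k0.+2)%:R + d%:R * (B k0)%:R) => k.
rewrite natrB//; have /andP[_ h2] := sB k.
rewrite -(ler_pM2l s0).
have hA : (k.+1)%:R * ((B k)%:R + (k.+1)%:R) <= (A k)%:R :> R.
  by rewrite -natrD -natrM ler_nat.
set a : R := (A k)%:R in h2 hA *; set b : R := (B k)%:R in h2 hA *.
set b' : R := (B k.+1)%:R in h2 *; set D : R := d%:R in dR1 sd h2 *.
have a0 : 0 <= a by exact: ler0n.
have b0 : 0 <= b by exact: ler0n.
have e : s * (t * b' - D * (a - b)) <= t * s * (k.+2)%:R + s * D * b - (s - t) * D * a.
  have : t * (s * b') <= t * (D * a + s * (k.+2)%:R) by rewrite ler_wpM2l.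
  lra.
apply: (le_trans e); have [kk0|k0k] := ltnP k k0.
  have b1 : b <= (B k0)%:R by rewrite ler_nat B_mono// ltnW.
  have k1 : (k.+2)%:R <= (k0.+2)%:R :> R by rewrite ler_nat !ltnS ltnW.
  have h3 : t * s * (k.+2)%:R <= t * s * (k0.+2)%:R by rewrite ler_wpM2l// mulr_ge0// ltW.
  have h4 : s * D * b <= s * D * (B k0)%:R.
    by rewrite ler_wpM2l// mulr_ge0// ltW// (lt_le_trans ltr01).
  have h5 : 0 <= (s - t) * D * a by rewrite !mulr_ge0// ltW// (lt_le_trans ltr01).
  lra.
have k1 : (k0.+1)%:R <= (k.+1)%:R :> R by rewrite ler_nat ltnS.
have h3 : 2 * s <= (s - t) * (k.+1)%:R by rewrite (le_trans hk0)// ler_pM2l.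
have D0 : 0 < D by exact: lt_le_trans dR1.
have bk0 : 0 <= b + (k.+1)%:R by rewrite addr_ge0.
have h4 : 2 * s * (D * (b + (k.+1)%:R)) <= (s - t) * D * a.
  apply: (@le_trans _ _ ((s - t) * (k.+1)%:R * (D * (b + (k.+1)%:R)))).
    by rewrite ler_wpM2r// mulr_ge0// ltW.
  have -> : (s - t) * (k.+1)%:R * (D * (b + (k.+1)%:R)) =
    (s - t) * D * ((k.+1)%:R * (b + (k.+1)%:R)) by ring.
  by rewrite ler_wpM2l// mulr_ge0// ltW.
have h5 : t * s * (k.+2)%:R <= D * s * (k.+2)%:R.
  by rewrite ler_wpM2r// ler_wpM2r ?(ltW s0)// (le_trans (ltW ts)).
have k2 : (k.+2)%:R = (k.+1)%:R + 1 :> R by rewrite natr1.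
have h6 : s * D <= s * D * (k.+1)%:R by rewrite ler_peMr ?ler1n// mulr_ge0// ltW.
have h7 : 0 <= s * D * b by rewrite !mulr_ge0// ltW.
have h8 : 0 <= s * (t * (k0.+2)%:R + D * (B k0)%:R).
  by rewrite mulr_ge0 ?(ltW s0)// addr_ge0 ?mulr_ge0// ltW.
rewrite k2 in h5 *; lra.
Qed.

(** With [g k b = - d * b] the end of the window [k] exactly compensates for the
    free digits before it, counting only those of the last gap [[B k, A k)], at the
    exponent [s] itself; [K] is chosen so large that the windows are not empty. *)
Lemma window_sequences_infinite (R : realType) (d : nat) (s : R) :
  (1 <= d)%N -> 0 < s -> s < d%:R -> exists A B : nat -> nat,
  [/\ B 0%N = 0%N, forall k, (B k <= A k)%N, forall k, (A k + k.+1 <= B k.+1)%N,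
      forall t, s < t -> forall N, exists2 k, (N <= k)%N &
        N%:R <= t * (B k.+1)%:R - d%:R * (A k)%:R &
      forall t, 0 <= t <= s -> exists G, forall k,
        t * (B k.+1)%:R - d%:R * (A k - B k)%:R <= G].
Proof.
move=> d1 s0 sd; have dR1 : 1 <= d%:R :> R by rewrite ler1n.
have ds0 : 0 < d%:R - s by rewrite subr_gt0.
have [k0 _ hK] := exists_nat_ge 0 d%:R ds0.
have [|A [B [B0 kA AB sB]]] :=
    @window_sequences R d k0.+1 s (fun _ b => - (d%:R * b%:R)) s0 isT.
  move=> k b; cbv zeta; set a := (k0.+1 * _)%N.
  have ha : (k0.+1)%:R * (b%:R + (k.+1)%:R) <= a%:R :> R.
    by rewrite -natrD -natrM ler_nat /a leq_pmul2l// -[leqLHS]mul1n leq_mul.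
  have h : d%:R * (b%:R + (k.+1)%:R) <= (d%:R - s) * a%:R :> R.
    apply: (@le_trans _ _ ((d%:R - s) * (k0.+1)%:R * (b%:R + (k.+1)%:R))).
      by rewrite ler_wpM2r// addr_ge0.
    by rewrite -mulrA ler_pM2l.
  have : s * (k.+1)%:R <= d%:R * (k.+1)%:R by rewrite ler_wpM2r// ltW.
  by rewrite natrD mulrDr; lra.
have BA k : (B k <= A k)%N.
  by apply: leq_trans (kA k); rewrite -[leqLHS]mul1n leq_mul// leq_addr.
exists A, B; split=> //; last first.
  move=> t /andP[t0 ts]; exists 0 => k; have /andP[_ h2] := sB k.
  rewrite natrB//; have : t * (B k.+1)%:R <= s * (B k.+1)%:R by rewrite ler_wpM2r.
  lra.
move=> t st N; have ts0 : 0 < t - s by rewrite subr_gt0.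
have t0 : 0 < t by exact: lt_trans st.
have [k Nk hk] := exists_nat_ge N (t * s + s * N%:R + t) ts0; exists k => //.
have /andP[h1 _] := sB k.
have hA : (k.+1)%:R * ((B k)%:R + (k.+1)%:R) <= (A k)%:R :> R.
  by rewrite -natrD -natrM ler_nat.
set a : R := (A k)%:R in h1 hA *; set b : R := (B k)%:R in h1 hA *.
set b' : R := (B k.+1)%:R in h1 *; set D : R := d%:R in dR1 sd h1 *.
have D0 : 0 < D by exact: lt_le_trans dR1.
have b0 : 0 <= b by exact: ler0n.
rewrite -(ler_pM2l s0).
have h3 : t * (D * a - D * b - s) <= t * (s * b') by rewrite ler_pM2l// ltW.
pose u := (t - s) * (k.+1)%:R.
have h4 : u * (D * (b + (k.+1)%:R)) <= (t - s) * D * a.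
  have -> : u * (D * (b + (k.+1)%:R)) = (t - s) * D * ((k.+1)%:R * (b + (k.+1)%:R)).
    by rewrite /u; ring.
  by rewrite ler_wpM2l// mulr_ge0// ltW.
have N0 : 0 <= N%:R :> R by exact: ler0n.
have ut : t <= u.
  have : 0 <= t * s + s * N%:R by rewrite addr_ge0 ?mulr_ge0// ltW.
  by rewrite /u; lra.
have u0 : 0 <= u by rewrite (le_trans (ltW t0)).
have h5 : t * (D * b) <= u * (D * b) by rewrite ler_wpM2r// mulr_ge0// ltW.
have h6 : u <= u * (D * (k.+1)%:R).
  by rewrite ler_peMr// -[X in X <= _]mulr1 ler_pM// ?ler1n.
have h7 : t * s + s * N%:R + t <= u := hk.
lra.
Qed.

(** * The examples *)

Section Dimension.
Context {R : realType} {d : nat}.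
Implicit Types E : set 'rV[R]_d.

Lemma hausdorff_null (t : R) E : 0 < t -> net (half_pow t) 0 E = 0%E ->
  hausdorff_measure t E = 0%E.
Proof.
move=> t0; apply: (@hausdorff_null_of_net R d d t t0 0 1%:M E) => y Ey.
by exists y => //; rewrite mulmx1 add0r.
Qed.

Lemma hausdorff_neq0 (t : R) E : 0 < t -> net (half_pow t) 0 E != 0%E ->
  hausdorff_measure t E <> 0%E.
Proof.
move=> t0 /eqP E0 H0; apply: E0.
have [C _ HC] := @net_le_hausdorff R d d t t0 0 1%:M 1%:M (mulmx1 _).
apply/le_anti; rewrite net_ge0 ?half_pow_gt0// andbT.
have := HC E E 0%N; rewrite H0 mule0; apply=> u Eu.
by rewrite add0r mulmx1.
Qed.

Lemma hausdorff0_neq0 E : E !=set0 -> hausdorff_measure (0 : R) E <> 0%E.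
Proof.
move=> [x Ex] H0; have : (1 <= hausdorff_premeasure (0 : R) 1 E)%E.
  apply: le_ereal_inf_tmp => _ [U [EU _] <-]; have [i _ Uix] := EU _ Ex.
  have U1 : diam_pow 0 (U i) = 1%E.
    rewrite /diam_pow; case: eqP => [Ui0|_]; last by rewrite poweRe0.
    by rewrite Ui0 in Uix.
  rewrite nneseries_esumT; last by move=> j; exact: diam_pow_ge0.
  rewrite -U1 -(esum_set1 (t := i) (a := fun i => diam_pow 0 (U i))); last exact: diam_pow_ge0.
  by apply: le_esum_subset => // j; exact: diam_pow_ge0.
apply/negP; rewrite -ltNge; apply: (@le_lt_trans _ _ 0%E); last exact: lte01.
by rewrite -H0; apply: hausdorff_premeasure_le_measure.
Qed.

Lemma hausdorff_dim_eq (s : R) E : 0 < s -> E !=set0 ->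
  (forall t, 0 < t < s -> hausdorff_measure t E <> 0%E) ->
  (forall t, s < t -> hausdorff_measure t E = 0%E) ->
  hausdorff_dim E = s%:E.
Proof.
move=> s0 Ene below above; apply/le_anti/andP; split.
  apply/lee_addgt0Pr => e e0; apply: ge_ereal_inf; exists (s + e)%:E => //.
  exists (s + e) => //; split; first by rewrite addr_ge0// ltW.
  by apply: above; rewrite ltrDl.
apply: le_ereal_inf_tmp => _ [t [t0 Ht] <-]; rewrite lee_fin leNgt; apply/negP => ts.
move: t0; rewrite le_eqVlt => /predU1P[t0|t0].
  by rewrite -t0 in Ht; exact: hausdorff0_neq0 Ht.
by apply: below Ht; rewrite t0.
Qed.

Lemma near_dyadic_nonempty (a b : nat -> nat) : near_dyadic (R := R) (d := d) a b !=set0.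
Proof. by exists (map_mx intr 0); exact: near_dyadic_int. Qed.

Lemma null_example (s : R) : (1 <= d)%N -> 0 < s <= d%:R ->
  exists E, [/\ borel_set E, hausdorff_dim E = s%:E, midpoint_convex E,
    ~ essentially_convex E & hausdorff_measure s E = 0%E].
Proof.
move=> d1 /andP[s0 sd].
have [A [B [B0 BA AB null pos]]] := window_sequences_null d1 s0 sd.
have AB' k : (A k + k <= B k.+1)%N by apply: leq_trans (AB k); rewrite leq_add2l.
have ABlt k : (A k < B k.+1)%N by apply: leq_trans (AB k); rewrite addnS ltnS leq_addr.
pose E : set 'rV[R]_d := near_dyadic A (fun k => B k.+1).
have zero t : s <= t -> hausdorff_measure t E = 0%E.
  move=> st; apply: hausdorff_null; first exact: lt_le_trans st.
  by apply: near_dyadic_null_exp => //; exact: null.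
exists E; split.
- exact: near_dyadic_borel.
- apply: hausdorff_dim_eq => // [|t /andP[t0 ts]|t /ltW/zero//].
    exact: near_dyadic_nonempty.
  apply: hausdorff_neq0 => //; apply: near_dyadic_pos => //.
    by rewrite ltW//= (le_trans (ltW ts)).
  by apply: pos; rewrite ltW.
- exact: near_dyadic_midpoint.
- exact: near_dyadic_not_essentially_convex.
- exact: zero.
Qed.

Lemma infinite_example (s : R) : (1 <= d)%N -> 0 < s < d%:R ->
  exists E, [/\ borel_set E, hausdorff_dim E = s%:E, midpoint_convex E,
    ~ essentially_convex E & hausdorff_measure s E = +oo%E].
Proof.
move=> d1 /andP[s0 sd].
have [A [B [B0 BA AB null pos]]] := window_sequences_infinite d1 s0 sd.
have AB' k : (A k + k <= B k.+1)%N by apply: leq_trans (AB k); rewrite leq_add2l.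
have ABlt k : (A k < B k.+1)%N by apply: leq_trans (AB k); rewrite addnS ltnS leq_addr.
pose E : set 'rV[R]_d := near_dyadic A (fun k => B k.+1).
have bE : borel_set E by exact: near_dyadic_borel.
have Emid : midpoint_convex E by exact: near_dyadic_midpoint.
have nE : ~ essentially_convex E by exact: near_dyadic_not_essentially_convex.
have nonzero t : 0 < t <= s -> hausdorff_measure t E <> 0%E.
  move=> /andP[t0 ts]; apply: hausdorff_neq0 => //; apply: near_dyadic_pos => //.
    by rewrite ltW//= (le_trans ts)// ltW.
  by apply: pos; rewrite ltW.
exists E; split=> //.
  apply: hausdorff_dim_eq => // [|t /andP[t0 ts]|t st].
  - exact: near_dyadic_nonempty.
  - by apply: nonzero; rewrite t0 ltW.
  - apply: hausdorff_null; first exact: lt_trans st.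
    by apply: near_dyadic_null_exp => //; exact: null.
have [//|//] := hausdorff_zero_or_infinite s0 bE Emid nE.
by move=> /(nonzero s); rewrite s0 lexx => /(_ isT).
Qed.

End Dimension.

Theorem theorem1p2 (R : realType) (d : nat) (d_ge1 : (1 <= d)%N) :
  (forall s : R, 0 < s < d%:R ->
     (forall E : set 'rV[R]_d,
        borel_set E -> midpoint_convex E -> ~ essentially_convex E ->
        hausdorff_measure s E = 0%E \/ hausdorff_measure s E = +oo%E) /\
     (exists E1 E2 : set 'rV[R]_d,
        [/\ borel_set E1, hausdorff_dim E1 = s%:E, midpoint_convex E1,
            ~ essentially_convex E1 & hausdorff_measure s E1 = 0%E] /\
        [/\ borel_set E2, hausdorff_dim E2 = s%:E, midpoint_convex E2,
            ~ essentially_convex E2 & hausdorff_measure s E2 = +oo%E])) /\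
  (exists E : set 'rV[R]_d,
     [/\ borel_set E, hausdorff_dim E = (d%:R : R)%:E, midpoint_convex E,
         ~ essentially_convex E & hausdorff_measure (d%:R : R) E = 0%E]).
Proof.
split=> [s s0d|].
  have /andP[s0 sd] := s0d; split=> [E|]; first exact: hausdorff_zero_or_infinite.
  have [|E1 E1P] := @null_example R d s d_ge1; first by rewrite s0 ltW.
  by have [E2 E2P] := infinite_example d_ge1 s0d; exists E1, E2.
by apply: null_example; rewrite // lexx ltr0n d_ge1.
Qed.
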